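(* Let $a_1$ and $a_2$ be relatively prime positive integers, not both equal to one. The right triangular billiard surface $Y:=X(a_1+a_2,a_1,a_2)$ is related to two isosceles triangular billiard surfaces $X_1$ and $X_2$ via translation covers $f_i:X_i\rightarrow Y$ ($i=1,2$). For each $i$, with $j$ denoting the other index in $\{1,2\}$: if $a_i$ is odd then $X_i=X(2a_j,a_i,a_i)$ and $f_i$ has degree $2$; if $a_i$ is even then $X_i=X\left(a_j,\dfrac{a_i}{2},\dfrac{a_i}{2}\right)$ and $f_i$ has degree $1$.
   Context: Triangular billiard surfaces. For a triple $(a_1,a_2,a_3)$ of positive integers with $\gcd(a_1,a_2,a_3)=1$ put $Q=a_1+a_2+a_3$, and let $T(a_1,a_2,a_3)$ be a Euclidean triangle with interior angles $a_1\pi/Q,\ a_2\pi/Q,\ a_3\pi/Q$. Let $D_{2Q}$ be the dihedral group of order $2Q$ generated by the (linear parts of the) reflections in the sides of $T=T(a_1,a_2,a_3)$. Take the $2Q$ copies $\delta\cdot T$, $\delta\in D_{2Q}$, and glue each copy, along its copy of each edge $e$ of $T$, by a translation to the copy which is its mirror image across that edge. The resulting closed surface, with its flat structure, is the triangular billiard surface $X(a_1,a_2,a_3)$. It is called right (resp. isosceles) if the triangle is right (resp. isosceles). The notation does not record the size and direction of the triangle; a statement that there is a translation cover between such surfaces refers to suitable choices of these. Translation covers. A translation surface is a compact flat surface with conical singularities (points with total cone angle $\neq 2\pi$) such that, after puncturing the singularities, all transition functions are translations. A translation cover $f:X\to Y$ is a holomorphic (possibly ramified) cover of translation surfaces such that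 in coordinate charts of the translation structures, restricted to open sets not containing singular points, $f$ is a translation. *)

(* Defs.v *)
(* MathComp / MathComp-Analysis *)
From HB Require Import structures.
From mathcomp Require Import all_boot all_order all_algebra.
From mathcomp Require Import all_classical all_reals all_analysis.
From mathcomp Require Import complex.
From Stdlib Require Import Relation_Operators Operators_Properties.

Set Implicit Arguments.
Unset Strict Implicit.
Unset Printing Implicit Defensive.

Import Order.TTheory GRing.Theory Num.Theory.
Import numFieldNormedType.Exports.

Local Open Scope classical_set_scope.
Local Open Scope quotient_scope.
Local Open Scope ring_scope.

(* The Euclidean plane, as the complex numbers; the ascription to
   numClosedFieldType gives it its topology and its complex derivative. *)
Definition plane (R : realType) : numClosedFieldType := R[i].

Section Triangle.
Context {R : realType}.
Local Notation C := (plane R).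

(* A triangle is given by its vertices. Indices in 'I_3 are taken modulo 3, so
   that the vertices other than v i are v (i + 1) and v (i - 1). *)
Implicit Types (v : 'I_3 -> C) (i : 'I_3).

Definition hull v : set C :=
  [set z | exists t : 'I_3 -> R, [/\ forall i, 0 <= t i, \sum_i t i = 1
    & z = \sum_i (t i)%:C%C * v i]].

(* The closed side opposite to v i. *)
Definition side v i : set C :=
  [set z | exists t : 'I_3 -> R, [/\ forall j, 0 <= t j, \sum_j t j = 1,
    t i = 0 & z = \sum_j (t j)%:C%C * v j]].

Definition vertex_angle v i : R :=
  let x : C := v (i + 1) - v i in
  let y : C := v (i - 1) - v i in
  acos (complex.Re (x * y^* / `|x * y|)).

(* The angle which the closed triangle subtends at one of its points. *)
Definition angle_at v (z : C) : R :=
  if [pick i | z == v i] is Some i then vertex_angle v i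
  else if `[< exists i, side v i z >] then pi else 2 * pi.

Definition nondegenerate_triangle v : Prop :=
  complex.Im ((v 1 - v 0)^* * (v (- 1) - v 0)) != 0.

(* v is a triangle T(a0, a1, a2), of any size and position. *)
Definition is_triangle (a0 a1 a2 : nat) v : Prop :=
  let Q := (a0 + a1 + a2)%N in
  [/\ [&& 0 < a0, 0 < a1 & 0 < a2]%N,
      gcdn a0 (gcdn a1 a2) = 1%N,
      nondegenerate_triangle v &
      [/\ vertex_angle v 0 = a0%:R * pi / Q%:R,
          vertex_angle v 1 = a1%:R * pi / Q%:R &
          vertex_angle v (- 1) = a2%:R * pi / Q%:R]].

(* The linear part of the reflection in the side opposite to v i. *)
Definition reflection v i : C -> C :=
  let u : C := v (i - 1) - v (i + 1) in fun z => u / u^* * z^*.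

(* The group generated by these reflections; they are involutions, so closing
   under products suffices. *)
Inductive dihedral v : set (C -> C) :=
| dihedral1 : dihedral v id
| dihedralM d i : dihedral v d -> dihedral v (d \o reflection v i).

(* The disjoint union of the copies d . T: the pair (d, p), with p in T, stands
   for the point d p of the copy d . T. *)
Definition copies v : topologicalType := {d : dihedral v & hull v}.

(* The mirror image of d . T across the copy d . e of the side e is, up to
   translation, (d \o r) . T with r the linear part of the reflection in e. The
   reflection in e itself is r + c for a constant c and fixes every p in e, so
   d p = (d \o r) p + d c: gluing d p to (d \o r) p, for p in e, is gluing d . e
   by a translation. *)
Definition glued v (x y : copies v) : Prop :=
  exists i, [/\ side v i (\val (tagged x)),
    \val (tag y) = \val (tag x) \o reflection v i
    & tagged y = tagged x].

Definition same_point v : rel (copies v) :=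
  fun x y => `[< clos_refl_sym_trans _ (@glued v) x y >].

Lemma same_point_equiv v : equiv_class_of (@same_point v).
Proof.
split=> [x|x y|y x z].
- exact/asboolP/rst_refl.
- by apply/asboolP/asboolP; apply: rst_sym.
- by move=> /asboolP xy /asboolP yz; apply/asboolP; apply: rst_trans xy yz.
Qed.

Canonical same_point_equivRel v :=
  EquivRelPack (@same_point_equiv v).

(* The underlying topological space of the triangular billiard surface. *)
Definition surface v : topologicalType :=
  quotient_topology {eq_quot (@same_point_equivRel v)}.

Definition surface_pt v (d : dihedral v) (p : hull v) : surface v :=
  \pi_(surface v) (existT (fun=> set_type (hull v)) d p : copies v).

Definition cone_angle v (x : surface v) : R :=
  \sum_(c \in [set c : copies v | \pi_(surface v) c = x])
    angle_at v (\val (tagged c)).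

(* Not a conical singularity. *)
Definition regular_points v : set (surface v) := [set x | cone_angle x = 2 * pi].
(* g is a flat coordinate on U, that is, a local primitive of dz: on each copy
   d . T it differs from the coordinate d p of the plane by a locally constant
   function. *)
Definition flat_on v (U : set (surface v)) (g : surface v -> C) : Prop :=
  forall (d : dihedral v) (p : hull v), U (surface_pt d p) ->
    \forall q \near p,
      g (surface_pt d q) - \val d (\val q) =
      g (surface_pt d p) - \val d (\val p).

End Triangle.

(* f restricts to a homeomorphism from the open set U onto an open set. *)
Definition open_embedding_on {X Y : topologicalType} (U : set X) (f : X -> Y) :=
  [/\ {in U, continuous f}, {in U &, injective f} &
      forall W, open W -> W `<=` U -> open (f @` W)].

Section Charts.
Context {R : realType}.
Local Notation C := (plane R).
Implicit Types v : 'I_3 -> C.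

Definition translation_chart v (U : set (surface v)) (phi : surface v -> C) :=
  [/\ open U, U `<=` @regular_points R v, flat_on U phi & open_embedding_on U phi].

(* A chart of the complex structure centred at a point x of cone angle 2 pi k:
   zeta ^+ k is a flat coordinate. At a regular point k = 1. *)
Definition complex_chart v (x : surface v) (k : nat) (U : set (surface v))
    (zeta : surface v -> C) :=
  [/\ cone_angle x = 2 * pi * k%:R,
      open U, U x, U `\ x `<=` @regular_points R v &
      [/\ zeta x = 0, flat_on U (fun z => zeta z ^+ k)
        & open_embedding_on U zeta]].

End Charts.

Section Covers.

Definition evenly_covered {X Y : topologicalType} (deg : nat) (f : X -> Y)
    (V : set Y) :=
  exists U : 'I_deg -> set X,
    [/\ forall s, open (U s), trivIset setT U, f @^-1` V = \bigcup_s U s &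
        forall s, open_embedding_on (U s) f /\ f @` U s = V].

(* B contains the branch points. *)
Definition ramified_cover {X Y : topologicalType} (deg : nat) (f : X -> Y) :=
  [/\ continuous f, range f = setT,
      forall y, finite_set (f @^-1` [set y]) &
      exists2 B : set Y, finite_set B &
        forall y, ~ B y -> exists V, [/\ open V, V y & evenly_covered deg f V]].

Context {R : realType}.
Local Notation C := (plane R).

Definition holomorphic (v w : 'I_3 -> C) (f : surface v -> surface w) :=
  forall x k U zeta, complex_chart x k U zeta ->
  forall y m V eta, complex_chart y m V eta ->
  forall z, U z -> V (f z) -> exists g : C -> C,
    derivable g (zeta z) 1 /\
    \forall z' \near z, eta (f z') = g (zeta z').

Definition translation_in_charts (v w : 'I_3 -> C)
    (f : surface v -> surface w) :=
  forall U phi, translation_chart U phi ->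
  forall V psi, translation_chart V psi ->
  forall z, U z -> V (f z) -> exists c : C,
    \forall z' \near z, psi (f z') = phi z' + c.

Definition translation_cover (v w : 'I_3 -> C) (deg : nat)
    (f : surface v -> surface w) :=
  [/\ ramified_cover deg f, holomorphic f & translation_in_charts f].

End Covers.

(* Main.v *)
Require Import Defs.
From mathcomp Require Import all_boot all_order all_algebra.
From mathcomp Require Import all_classical all_reals all_analysis.
From mathcomp Require Import complex.
From mathcomp Require Import ring lra zify.
From Stdlib Require Import Relation_Operators.

(** Cut the isosceles triangle v along its axis of symmetry: each half is a copy
    of the right triangle w.  Folding v onto w along that axis sends the copy
    d . v to the two copies d . w and (d rho) . w, where rho is the reflection in
    the axis, because d z = (d rho) (rho z).  This formula also says that the
    fold, read in the copies, is a translation.  It respects the gluings: the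
    two equal sides of v both become the hypotenuse of w, the base becomes a
    leg, and crossing the axis inside d . v becomes the gluing of d . w to
    (d rho) . w.

    Conversely a copy dl . w is covered by the right half of dl . v if dl is in
    the group of v, and by the left half of (dl rho) . v if dl rho is; every dl
    in the group of w falls in at least one of these cases ([dih_w_v]).  These
    lifts follow the gluings of w ([lift_glue]), so they make up exactly the
    fibre of the fold ([fold_fiber]).  Hence the fold is continuous, open and
    onto, and all depends on how the two groups compare.

    Up to composition with the reflection in the base, the elements of the group
    of v are the powers of omega, the rotation by twice the base angle
    a_i pi / (2 (a_1 + a_2)); so omega ^+ (a_1 + a_2) is the rotation by a_i pi,
    that is (-1) ^+ a_i ([omega_pow]).  The group of w has the further generator
    rho, which is minus the reflection in the base.
    - If a_i is even then a_1 + a_2 is odd, and the group of v does not contain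
      the rotation by pi; so exactly one lift exists and the fold is a
      homeomorphism ([fold_ramified1]).
    - If a_i is odd the two groups coincide, and the fibres are the orbits of
      the involution which sends the point p of d . v to the point rho p of
      (d rho) . v.  It has fixed points only over the two ends of the axis, and
      away from them the covering sheets are explicit ([fold_ramified2]).

    The fold pulls flat coordinates back to flat coordinates ([fold_flat]),
    which gives the translation property at once.  In complex charts eta and
    zeta it says that the m-th power of eta o f is zeta ^+ k plus a constant, so
    eta o f is an m-th root of a holomorphic function of zeta.  Such a root is
    holomorphic where it does not vanish; where it does, one needs m <= k, that
    is, that cone angles do not increase under the fold ([cone_angle_fold]). *)

Set Implicit Arguments.
Unset Strict Implicit.
Unset Printing Implicit Defensive.

Import Order.TTheory GRing.Theory Num.Theory.
Import numFieldNormedType.Exports.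

Local Open Scope classical_set_scope.
Local Open Scope quotient_scope.
Local Open Scope ring_scope.

(** * Complex conjugation and roots of holomorphic functions *)

Section Conjugate.
Context {R : realType}.
Local Notation C := (plane R).

Lemma conj_real (x : R) : (x%:C%C : C)^* = x%:C%C.
Proof. by apply/eqP; rewrite eq_complex/= oppr0 !eqxx. Qed.

Lemma conj_i : ('i%C : C)^* = - 'i%C.
Proof. by apply/eqP; rewrite eq_complex/= oppr0 !eqxx. Qed.

Lemma axis_scale (r : R) (x : C) : r != 0 ->
  (r%:C%C * x) / (r%:C%C * x)^* = x / x^*.
Proof.
move=> r0; have rC0 : r%:C%C != 0 :> C by rewrite eq_complex/= negb_and r0.
by rewrite rmorphM/= conj_real -mulf_div divff// mul1r.
Qed.

End Conjugate.

Section Powers.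
Context {K : numClosedFieldType}.

Lemma cvg_exp (T : Type) (F : set_system T) (FF : Filter F) (g : T -> K) (l : K)
    (n : nat) : g x @[x --> F] --> l -> g x ^+ n @[x --> F] --> l ^+ n.
Proof.
move=> gl; elim: n => [|n IHn].
  by rewrite expr0; under eq_cvg do rewrite expr0; exact: cvg_cst.
by rewrite exprS; under eq_cvg do rewrite exprS; exact: cvgM.
Qed.

Lemma near_derivable (f g : K -> K) (c : K) : (\forall x \near c, f x = g x) ->
  derivable f c 1 -> derivable g c 1.
Proof. exact: near_eq_derivable. Qed.

Lemma derivable_scale (a c : K) : derivable (fun x : K => a * x : K) c 1.
Proof. by apply: derivableM; [exact: derivable_cst|exact: derivable_id]. Qed.

Lemma continuous_div_id (g : K -> K) (c : K) : c != 0 ->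
  {for c, continuous g} -> {for c, continuous (fun x => g x / x)}.
Proof. by move=> c0 gc; apply: continuousM => //; exact: inv_continuous. Qed.

Lemma derivable_exp_add (k : nat) (e c : K) : derivable (fun x : K => x ^+ k + e : K) c 1.
Proof. by apply: derivableD; [exact: exprn_derivable|exact: derivable_cst]. Qed.

Lemma cvg_shift_dnbhs (g : K -> K) (c : K) : {for c, continuous g} ->
  g (h *: 1 + c) @[h --> 0^'] --> g c.
Proof.
move=> gc.
have sc : (h *: 1 + c : K) @[h --> (0 : K)^'] --> c.
  rewrite -[X in _ --> X]add0r; under eq_cvg do rewrite [_ *: _]mulr1.
  by apply: cvgD; [exact: cvg_within|exact: cvg_cst].
exact: (cvg_comp _ _ sc gc).
Qed.

(** From the factorisation of a difference of m-th powers, the difference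
    quotient of g is that of g ^+ m divided by a sum which tends to
    m g(c) ^+ (m - 1), and this limit is not 0. *)
Lemma derivable_root (m : nat) (g : K -> K) (c : K) : (0 < m)%N ->
  {for c, continuous g} -> g c != 0 ->
  derivable (fun x => g x ^+ m) c 1 -> derivable g c 1.
Proof.
move=> m0 gc gc0 dg.
have gcvg := cvg_shift_dnbhs gc.
pose S (h : K) := \sum_(i < m) g (h *: 1 + c) ^+ (m.-1 - i) * g c ^+ i.
have SE : S h @[h --> 0^'] --> \sum_(i < m) g c ^+ (m.-1 - i) * g c ^+ i.
  apply: cvg_big => [|i _]; first exact: add_continuous.
  apply: cvgM; last exact: cvg_cst.
  exact: cvg_exp.
have lS0 : \sum_(i < m) g c ^+ (m.-1 - i) * g c ^+ i != 0.
  rewrite (eq_bigr (fun=> g c ^+ m.-1)) => [|i _].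
    by rewrite sumr_const card_ord mulrn_eq0 negb_or -lt0n m0 expf_neq0.
  by rewrite -exprD subnK// -ltnS prednK.
rewrite /derivable in dg *.
have := cvgM dg (cvgV lS0 SE); set L := (L in _ --> L).
move=> /(_ (dnbhs_filter _) (dnbhs_filter _)) dgS.
apply/cvg_ex; exists L; apply: cvg_trans dgS; apply: near_eq_cvg.
have Snz : \forall h \near (0:K)^', S h != 0.
  exact: (cvgr_neq0 _ SE lS0).
near=> h; rewrite /= /shift/=.
have Sh : S h != 0 by near: h.
rewrite subrXX -[X in _ *: (_ * X)]/(S h).
by rewrite /= -[X in _ / X]/(S h) scalerAl mulfK.
Unshelve. all: by end_near. Qed.

End Powers.

Section Plane.
Context {R : realType}.
Local Notation C := (plane R).

Lemma re_continuous : continuous (fun z : C => complex.Re z : R).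
Proof.
move=> z; apply: (iffRL (@cvgrPdist_lt _ _ _ _ (nbhs_filter z) _ _)) => e e0.
have e0' : 0 < e%:C%C :> C by rewrite ltcR.
near=> y; rewrite -ltcR -raddfB; apply: le_lt_trans (normc_ge_Re _) _.
by near: y; exact: nbhsx_ballx.
Unshelve. all: by end_near. Qed.

Lemma im_continuous : continuous (fun z : C => complex.Im z : R).
Proof.
have -> : (fun z : C => complex.Im z : R) = (fun z : C => complex.Re ((- 'i%C : C) * z)).
  by apply/funext => -[x y] /=; rewrite oppr0 mul0r sub0r mulN1r opprK.
move=> z; apply: (@continuous_comp C C R (fun z => (- 'i%C : C) * z)).
  exact: mulrl_continuous.
exact: re_continuous.
Qed.

Lemma real_complex_continuous : continuous (fun x : R => x%:C%C : C).
Proof.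
move=> x; apply: (iffRL (@cvgrPdist_lt _ _ _ _ (nbhs_filter x) _ _)) => e e0.
have [e1 e1E] : exists r : R, e = r%:C%C.
  move: (ltW e0); case: (e : R[i]) => r s; rewrite lecE/= => /andP[/eqP -> _].
  by exists r.
rewrite e1E in e0 *; have e10 : 0 < e1 by rewrite -ltcR.
near=> y; rewrite -raddfB normc_def/= expr0n/= addr0 sqrtr_sqr ltcR.
by near: y; exact: nbhsx_ballx.
Unshelve. all: by end_near. Qed.

Lemma conj_continuous : continuous (fun z : C => z^*).
Proof.
move=> z; apply: (iffRL (@cvgrPdist_lt _ _ _ _ (nbhs_filter z) _ _)) => e e0.
near=> y; rewrite -rmorphB/= norm_conjC.
by near: y; exact: nbhsx_ballx.
Unshelve. all: by end_near. Qed.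

Lemma finite_unity_roots (m : nat) : (0 < m)%N -> finite_set [set x : C | x ^+ m = 1].
Proof.
move=> m0.
have [r rE] := closed_field_poly_normal ('X^m - 1 : {poly C}).
apply: (@sub_finite_set _ _ [set` r]); last exact: finite_seq.
move=> x /= xm; have : root ('X^m - 1 : {poly C}) x.
  by rewrite /root !hornerE xm subrr.
rewrite rE rootZ ?root_prod_XsubC//.
by rewrite lead_coef_eq0 -size_poly_eq0 size_XnsubC.
Qed.

(** The m-th roots of unity form a finite, hence discrete, set, while the image
    of a segment is connected. *)
Lemma segment_constant_root (m : nat) (phi : C -> C) (h1 h2 : C) : (0 < m)%N ->
  (forall t : R, 0 <= t <= 1 -> let h := h1 + t%:C%C * (h2 - h1) in
     {for h, continuous phi} /\ phi h ^+ m = 1) ->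
  phi h1 = phi h2.
Proof.
move=> m0 H.
pose ga (t : R) : C := h1 + t%:C%C * (h2 - h1).
have gac : continuous ga.
  move=> t; apply: cvgD; first exact: cvg_cst.
  apply: cvgM; last exact: cvg_cst.
  exact: real_complex_continuous.
pose A := (phi \o ga) @` `[0, 1].
have cA : connected A.
  apply: connected_continuous_connected; first exact: segment_connected.
  apply: continuous_in_subspaceT => t; rewrite inE/= in_itv/= => t01.
  by apply: continuous_comp; [exact: gac|exact: (H _ t01).1].
have ga0 : ga 0 = h1 by rewrite /ga mul0r addr0.
have ga1 : ga 1 = h2 by rewrite /ga mul1r addrC subrK.
have A1 : A (phi h1) by exists 0; rewrite /= ?ga0// in_itv/= lexx ler01.
have A2 : A (phi h2) by exists 1; rewrite /= ?ga1// in_itv/= lexx ler01.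
have AF : A `<=` [set x | x ^+ m = 1].
  by move=> _ [t + <-]; rewrite /= in_itv/= => /H[].
have accC : accessible_space C.
  exact/hausdorff_accessible/norm_hausdorff.
have fcl := iffLR accessible_finite_set_closed accC.
suff AE : [set phi h1] = A.
  by have : [set phi h1] (phi h2) by rewrite AE.
apply: cA; first by exists (phi h1).
- exists (~` ([set x | x ^+ m = 1] `\ phi h1)).
    apply: closed_openC; apply: fcl; apply: finite_setD.
    exact: finite_unity_roots.
  apply/seteqP; split=> [x ->|x [Ax]].
    by split=> // -[_]; exact.
  by move=> nx; apply: contrapT => xh; apply: nx; split=> //; exact: AF.
- exists [set phi h1]; first by apply: fcl; exact: finite_set1.
  by apply/seteqP; split=> [x ->|x [_ ->]].
Qed.

(** The punctured plane is path connected: if the segment from h1 to h2 meets 0,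
    then h2 is a negative multiple of h1 and one turns by a right angle first. *)
Lemma segment_avoids0 (h1 h2 : C) : h1 != 0 -> h2 != 0 ->
  let ok h h' := forall t : R, 0 <= t <= 1 -> h + t%:C%C * (h' - h) != 0 in
  ok h1 h2 \/ (ok h1 ('i%C * h1) /\ ok ('i%C * h1) h2).
Proof.
move=> h10 h20 ok; have [|/existsNP[t /not_implyP[t01 /negP]]] := pselect (ok h1 h2).
  by left.
rewrite negbK => /eqP e; right.
have t0 : t != 0 by apply: contra_neq h10 => t0; move: e; rewrite t0 mul0r addr0.
have tC0 : t%:C%C != 0 :> C by rewrite eq_complex/= negb_and t0.
have [s h2E] : exists s : R, h2 = - (s%:C%C * h1).
  exists ((1 - t) / t).
  have : t%:C%C * h2 = - ((1 - t)%:C%C * h1).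
    rewrite rmorphB rmorph1; apply/eqP; rewrite -subr_eq0 opprK -e; apply/eqP; ring.
  rewrite rmorphM/= fmorphV/= => e'.
  by apply: (mulfI tC0); rewrite e'; field.
have s0 : s != 0 by apply: contra_neq h20 => s0; rewrite h2E s0 mul0r oppr0.
split=> u u01.
  have -> : h1 + u%:C%C * ('i%C * h1 - h1) = h1 * (1 - u%:C%C + u%:C%C * 'i%C) by ring.
  rewrite mulf_neq0//; apply/eqP => /eqP; rewrite eq_complex/= => /andP[].
  by rewrite !(mul0r, mulr0, mulr1, subr0, oppr0, addr0, add0r) => /eqP + /eqP u0; rewrite u0 subr0 => /eqP; rewrite oner_eq0.
have -> : 'i%C * h1 + u%:C%C * (h2 - 'i%C * h1) =
  h1 * ((1 - u%:C%C) * 'i%C - u%:C%C * s%:C%C) by rewrite h2E; ring.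
rewrite mulf_neq0//; apply/eqP => /eqP; rewrite eq_complex/= => /andP[].
rewrite !(mul0r, mulr0, mulr1, subr0, oppr0, addr0, add0r) => /eqP + /eqP u1.
have -> : u = 1 by lra.
by rewrite mul1r => /eqP; rewrite oppr_eq0 (negPf s0).
Qed.

(** The path of [segment_avoids0] joins h1 to h2 within the disc of radius e: a
    point of a segment is at distance at most twice the larger modulus plus the
    smaller one from 0, hence the factor 1 / 3. *)
Lemma punctured_constant_root (m : nat) (phi : C -> C) (e : C) : (0 < m)%N ->
  (forall h, h != 0 -> `|h| < e -> {for h, continuous phi} /\ phi h ^+ m = 1) ->
  forall h1 h2, h1 != 0 -> h2 != 0 -> `|h1| < e / 3 -> `|h2| < e / 3 ->
    phi h1 = phi h2.
Proof.
move=> m0 H.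
have step h1 h2 : `|h1| < e / 3 -> `|h2| < e / 3 ->
    (forall t : R, 0 <= t <= 1 -> h1 + t%:C%C * (h2 - h1) != 0) -> phi h1 = phi h2.
  move=> l1 l2 ok; apply: (segment_constant_root m0) => t t01 h.
  apply: H; first exact: ok.
  have -> : e = e / 3 + (e / 3 + e / 3) by field.
  rewrite /h; apply: le_lt_trans (ler_normD _ _) _; apply: ltrD => //.
  apply: le_lt_trans (ltrD l2 l1).
  rewrite normrM; apply: le_trans (ler_normB _ _).
  rewrite -[leRHS]mul1r ler_wpM2r// normc_def/= expr0n/= addr0 sqrtr_sqr.
  by move: t01 => /andP[t0 t1]; rewrite ger0_norm// lecR.
move=> h1 h2 h10 h20 l1 l2.
have l3 : `|'i%C * h1| < e / 3.
  by rewrite normrM normc_def/= expr0n/= add0r expr1n sqrtr1 mul1r.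
have [ok|[ok1 ok2]] := segment_avoids0 h10 h20; first exact: step.
by rewrite (step _ _ l1 l3 ok1) (step _ _ l3 l2 ok2).
Qed.

(** If m < k, the difference quotient of g at 0 has modulus a positive power of
    that of c, so the derivative is 0.  If m = k, the quotient g c / c is a
    continuous root of unity on a punctured disc, hence a constant. *)
Lemma derivable_root0 (m k : nat) (g : C -> C) : (0 < m <= k)%N ->
  (\forall c \near (0 : C), {for c, continuous g} /\ g c ^+ m = c ^+ k) ->
  derivable g (0 : C) 1.
Proof.
move=> /andP[m0 mk] /nbhs_ballP[e /= e0 H].
have {}H c : `|c| < e -> {for c, continuous g} /\ g c ^+ m = c ^+ k.
  by move=> ce; apply: H; rewrite /ball/= sub0r normrN.
have g0 : g 0 = 0.
  have [_ /eqP] := H 0 ltac:(by rewrite normr0).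
  by rewrite expr0n [k == _]gtn_eqF ?(leq_trans m0)// expf_eq0 m0/= => /eqP.
move: mk; rewrite leq_eqVlt => /predU1P[mk|mk].
- pose phi c := g c / c.
  have phiP h : h != 0 -> `|h| < e -> {for h, continuous phi} /\ phi h ^+ m = 1.
    move=> h0 he; have [gc gE] := H h he; split.
      exact: continuous_div_id.
    by rewrite expr_div_n gE mk divff// expf_neq0.
  have e30 : 0 < e / 3 by rewrite divr_gt0.
  have e60 : 0 < e / 6 by rewrite divr_gt0.
  have e6 : `|e / 6| < e / 3.
    rewrite gtr0_norm// -subr_gt0 (_ : _ - _ = e / 6)//; by field.
  refine (@near_derivable C (fun c : C => phi (e / 6) * c) _ _ _ _).
    have : \forall c \near (0 : C), `|c| < e / 3.
      apply/nbhs_ballP; exists (e / 3) => // c.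
      by rewrite /ball/= sub0r normrN.
    apply: filterS => c ce; have [->|c0] := eqVneq c 0; first by rewrite g0 mulr0.
    rewrite -(punctured_constant_root m0 phiP c0 _ ce e6) ?gt_eqF//.
    by rewrite /phi mulfVK.
  exact: derivable_scale.
- rewrite /derivable g0; apply/cvg_ex; exists 0.
  apply: (iffRL (@cvgrPdist_lt _ _ _ _ (dnbhs_filter _) _ _)) => d d0.
  near=> h; rewrite sub0r normrN /= /shift/= addr0 subr0 [h *: 1]mulr1.
  have h0 : h != 0 by near: h; exact: nbhs_dnbhs_neq.
  have [_ gE] : {for h, continuous g} /\ g h ^+ m = h ^+ k.
    apply: H; near: h; apply: nbhs_dnbhs; apply/nbhs_ballP; exists e => // c.
    by rewrite /ball/= sub0r normrN.
  rewrite -(@ltr_pXn2r _ m)// ?nnegrE ?(ltW d0)// -normrX exprMn gE.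
  rewrite (_ : h^-1 ^+ m * h ^+ k = h ^+ (k - m)); last first.
    by rewrite expfB// mulrC exprVn.
  have h1 : `|h| < 1.
    near: h; apply: nbhs_dnbhs; apply/nbhs_ballP; exists 1; first exact: ltr01.
    by move=> c; rewrite /ball/= sub0r normrN.
  rewrite normrX; apply: (@le_lt_trans _ _ `|h|).
    rewrite -[leRHS]expr1; apply: ler_wiXn2l => //; last by rewrite subn_gt0.
    exact: ltW.
  near: h; apply: nbhs_dnbhs; apply/nbhs_ballP; exists (d ^+ m).
    exact: exprn_gt0.
  by move=> c; rewrite /ball/= sub0r normrN.
Unshelve. all: by end_near. Qed.

End Plane.

(** * Points of the surface of a triangle *)

Lemma ord3_ind (P : 'I_3 -> Prop) : P 0 -> P 1 -> P (- 1) -> forall i, P i.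
Proof.
move=> P0 P1 P2 [[|[|[|//]]] lti].
- by rewrite (_ : Ordinal _ = 0)//; apply/val_inj.
- by rewrite (_ : Ordinal _ = 1)//; apply/val_inj.
- by rewrite (_ : Ordinal _ = -1)//; apply/val_inj.
Qed.

Lemma sum_ord3 (V : nmodType) (F : 'I_3 -> V) : \sum_i F i = F 0 + F 1 + F (-1).
Proof.
rewrite !big_ord_recl big_ord0 addr0 addrA; congr (F _ + F _ + F _); exact: val_inj.
Qed.

Lemma ord3E : [/\ (0 - 1 : 'I_3) = -1, (1 + 1 : 'I_3) = -1, (-1 - 1 : 'I_3) = 1 &
  (-1 + 1 : 'I_3) = 0].
Proof. by split; apply/val_inj. Qed.

(** Carries neighbourhoods in the subspace type of A over to the ambient space,
    so that closed triangles can be handled as sets of complex numbers. *)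
Lemma near_set_type (T : topologicalType) (A : set T) (p : A) (P : set T) :
  (\forall q \near p, P (\val q)) <-> (\forall z \near \val p, A z -> P z).
Proof.
split=> [[B [[C oC CB] Bp] BP]|].
  have Cp : C (\val p) by rewrite -CB in Bp.
  have /filterS : nbhs (\val p) C by exact: open_nbhs_nbhs.
  apply=> z Cz Az.
  have Bz : B (SigSub (mem_set Az)) by rewrite -CB.
  exact: (BP _ Bz).
rewrite {1}/prop_near1 nbhsE => -[C [oC Cp] CP].
exists (\val @^-1` C); split; [by exists C|exact: Cp|].
by move=> q /= Cq; apply: CP => //; exact: set_valP.
Qed.

Section Surface.
Context {R : realType}.
Local Notation C := (plane R).
Implicit Types (v : 'I_3 -> C) (i : 'I_3) (d : C -> C) (p q z : C).

Lemma hull_vertex v i : hull v (v i).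
Proof.
exists (fun j => (j == i)%:R); split.
- by move=> j; case: (j == i).
- by rewrite (bigD1 i)//= eqxx big1 ?addr0// => j /negPf ->.
- rewrite (bigD1 i)//= eqxx mul1r big1 ?addr0// => j /negPf ->.
  by rewrite mul0r.
Qed.

Definition dihedral_id v : dihedral v := SigSub (mem_set (@dihedral1 R v)).
Definition hull_v0 v : hull v := SigSub (mem_set (hull_vertex v 0)).

(** A total version of [surface_pt], which spares the membership proofs; its
    value means something only when d is in the dihedral group and p in the
    triangle. *)
Definition pt v d p : surface v :=
  surface_pt (insubd (dihedral_id v) d) (insubd (hull_v0 v) p).

Lemma pt_surface_pt v (d : dihedral v) (p : hull v) :
  surface_pt d p = pt v (\val d) (\val p).
Proof. by rewrite /pt !valKd. Qed.

Lemma surface_ind v (P : surface v -> Prop) :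
  (forall d p, dihedral v d -> hull v p -> P (pt v d p)) -> forall x, P x.
Proof.
move=> H x; elim/quotW: x => -[d p]; have := H _ _ (set_valP d) (set_valP p).
by rewrite -pt_surface_pt.
Qed.

Lemma val_dihedral v d : dihedral v d -> \val (insubd (dihedral_id v) d) = d.
Proof. by move=> vd; rewrite val_insubd mem_set. Qed.
Lemma val_hull v p : hull v p -> \val (insubd (hull_v0 v) p) = p.
Proof. by move=> vd; rewrite val_insubd mem_set. Qed.

Lemma side_hull v i p : side v i p -> hull v p.
Proof. by move=> [t [? ? ? ?]]; exists t. Qed.

Lemma pt_glue v d i p : dihedral v d -> side v i p ->
  pt v d p = pt v (d \o reflection v i) p.
Proof.
move=> vd sp; apply/eqmodP/asboolP/rst_step; exists i; split => //=.
- by rewrite val_hull//; exact: side_hull sp.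
- by rewrite !val_dihedral//; exact: dihedralM.
Qed.

(** Functions on the surface are functions on the copies which agree along the
    glued sides. *)
Lemma pt_rec v (T : Type) (F : (C -> C) -> C -> T) :
  (forall d i p, dihedral v d -> side v i p ->
     F d p = F (d \o reflection v i) p) ->
  exists f : surface v -> T,
    forall d p, dihedral v d -> hull v p -> f (pt v d p) = F d p.
Proof.
move=> FE.
pose F' (c : copies v) := F (\val (tag c)) (\val (tagged c)).
exists (fun x => F' (repr x)) => d p vd vp.
have : same_point (repr (pt v d p))
   (existT _ (insubd (dihedral_id v) d) (insubd (hull_v0 v) p) : copies v).
  by apply/eqmodP; rewrite reprK.
have -> : F d p = F' (existT _ (insubd (dihedral_id v) d) (insubd (hull_v0 v) p)).
  by rewrite /F' /= val_dihedral// val_hull.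
move/asboolP; elim=> [x y|//|x y _ -> //|x y z _ -> _ -> //].
move=> [i [sx dy py]]; rewrite /F' py dy; apply: FE => //; exact: set_valP.
Qed.

(** How an equality of points of the surface is used: what is invariant under crossing
    a side through p is shared by all representatives of a point. *)
Lemma pt_eq_ind v (P : (C -> C) -> C -> Prop) :
  (forall d i p, dihedral v d -> side v i p ->
     P d p <-> P (d \o reflection v i) p) ->
  forall d d' p p', dihedral v d -> dihedral v d' -> hull v p -> hull v p' ->
    pt v d p = pt v d' p' -> P d p -> P d' p'.
Proof.
move=> HP d d' p p' vd vd' vp vp' e Pp.
have [f fE] := pt_rec (fun d i p vd sp => propext (HP d i p vd sp)).
by rewrite -fE// -e fE.
Qed.

Lemma pt_inj v d d' p p' : dihedral v d -> dihedral v d' -> hull v p ->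
  hull v p' -> pt v d p = pt v d' p' -> p = p'.
Proof.
move=> vd vd' vp vp' /(pt_eq_ind (P := fun _ q => p = q)); apply => //.
Qed.

(** The gluing identifies points of sides only. *)
Lemma pt_inj_interior v d d' p : dihedral v d -> dihedral v d' -> hull v p ->
  (forall i, ~ side v i p) -> pt v d p = pt v d' p -> d = d'.
Proof.
move=> vd vd' vp sp.
move/(pt_eq_ind (P := fun e q => (forall i, ~ side v i q) -> d = e)); apply => //.
by move=> e i q _ si; split=> H /(_ i).
Qed.

Lemma near_pt v d p (P : surface v -> C -> Prop) : dihedral v d -> hull v p ->
  (\forall q \near (insubd (hull_v0 v) p : hull v),
     P (surface_pt (insubd (dihedral_id v) d) q) (\val q)) <->
  (\forall z \near p, hull v z -> P (pt v d z) z).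
Proof.
move=> vd vp.
have := @near_set_type C (hull v) (insubd (hull_v0 v) p) (fun z => P (pt v d z) z).
rewrite val_hull// => <-.
by split; apply: filterS => q; rewrite /pt valKd.
Qed.

(** Openness in the quotient is tested copy by copy, and there with
    neighbourhoods in the plane. *)
Lemma open_surfaceP v (A : set (surface v)) : open A <->
  forall d p, dihedral v d -> hull v p -> A (pt v d p) ->
    \forall q \near p, hull v q -> A (pt v d q).
Proof.
split=> [|H].
  rewrite {1}/open/= /quotient_open => /sigT_openP oA d p vd vp Ap.
  have := oA (insubd (dihedral_id v) d); rewrite openE => /(_ _ Ap).
  by move=> /(near_pt (fun x _ => A x) vd vp).
rewrite /open/= /quotient_open; apply/sigT_openP => d.
rewrite openE => p Ap; have := H _ _ (set_valP d) (set_valP p).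
rewrite -pt_surface_pt => /(_ Ap).
move=> /(near_pt (fun x _ => A x) (set_valP d) (set_valP p)).
by rewrite !valKd.
Qed.

Lemma flat_onP v (U : set (surface v)) g : flat_on U g <->
  forall d p, dihedral v d -> hull v p -> U (pt v d p) ->
    \forall q \near p, hull v q -> g (pt v d q) - d q = g (pt v d p) - d p.
Proof.
split=> H.
  move=> d p vd vp Up.
  have := H _ _ Up; rewrite val_dihedral// val_hull//.
  by move=> /(near_pt (fun x z => g x - d z = g (pt v d p) - d p) vd vp).
move=> d p Up; have := H _ _ (set_valP d) (set_valP p).
rewrite -pt_surface_pt => /(_ Up).
move=> /(near_pt (fun x z => g x - \val d z = g _ - \val d _) (set_valP d) (set_valP p)).
by rewrite !valKd.
Qed.

End Surface.

(** * Maps which are translations in flat coordinates *)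

(** An inverse which is defined everywhere, so that coordinate changes are
    honest functions of the plane. *)
Lemma open_embedding_inverse (X Y : topologicalType) (U : set X) (h : X -> Y) :
  open U -> open_embedding_on U h ->
  forall z, U z -> exists inv : Y -> X,
    [/\ forall x, U x -> inv (h x) = x,
        forall x, U x -> {for h x, continuous inv} &
        forall x, U x -> \forall c \near h x, U (inv c) /\ h (inv c) = c].
Proof.
move=> oU [ch ih oh] z Uz.
pose inv c := xget z [set x | U x /\ h x = c].
have invK x : U x -> inv (h x) = x.
  move=> Ux; rewrite /inv; case: xgetP => [y _ [Uy hy]|/(_ x)[]//].
  by apply: ih; rewrite ?inE.
have near_inv x (N : set X) : U x -> nbhs x N ->
    \forall c \near h x, exists y, [/\ N y, U y & h y = c].
  move=> Ux; rewrite nbhsE => -[W [oW Wx] WN].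
  have oUW : open (h @` (U `&` W)) by apply: oh; [exact: openI|exact: subIsetl].
  apply: filterS (open_nbhs_nbhs (conj oUW _)); last by exists x.
  by move=> c [y [Uy Wy] <-]; exists y; split=> //; exact: WN.
exists inv; split=> //.
  move=> x Ux N; rewrite invK// => /(near_inv _ _ Ux); apply: filterS.
  by move=> c [y [Ny Uy <-]]/=; rewrite invK.
move=> x Ux; apply: filterS (near_inv _ _ Ux filterT) => c [y [_ Uy <-]].
by rewrite invK.
Qed.

Section FlatPullback.
Context {R : realType}.
Local Notation C := (plane R).
Implicit Types (v w : 'I_3 -> C).

(** On each copy both functions are the coordinate up to local constants, so the
    set where the difference keeps its value at z is open copy by copy, hence
    open in the quotient. *)
Lemma flat_sub v (U : set (surface v)) g h : open U -> flat_on U g -> flat_on U h ->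
  forall z, U z -> \forall z' \near z, g z' - h z' = g z - h z.
Proof.
move=> /open_surfaceP oU /flat_onP fg /flat_onP fh z Uz.
pose A : set (surface v) := [set x | U x /\ g x - h x = g z - h z].
have oA : open A.
  apply/open_surfaceP => d p vd vp [Ux e].
  move: (oU _ _ vd vp Ux) (fg _ _ vd vp Ux) (fh _ _ vd vp Ux).
  apply: filterS3 => q Uq gq hq vq; split; first exact: Uq.
  by rewrite -e -(subrKA (d q)) -[in RHS](subrKA (d p)) gq// -[d q - h _]opprB hq// opprB.
apply: filterS (open_nbhs_nbhs (conj oA _)); last by split.
by move=> x [].
Qed.

(** With zeta and eta the two charts, (eta o f) ^+ m and zeta ^+ k are flat, so
    they differ by a constant near z.  The inequality of cone angles rules out
    that eta o f is a proper fractional power of zeta at one of its zeros. *)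
Lemma holomorphic_of_flat v w (f : surface v -> surface w) :
  continuous f ->
  (forall V psi, open V -> flat_on V psi -> flat_on (f @^-1` V) (psi \o f)) ->
  (forall y : surface w, 0 < cone_angle y) ->
  (forall x, cone_angle (f x) <= cone_angle x) ->
  holomorphic f.
Proof.
move=> cf ff wa fa x k U zeta [kx oU Ux Ureg [zx fz ez]] y m V eta
  [my oV Vy Vreg [ey fe ee]] z Uz Vfz.
have twopi0 : 0 < 2 * pi :> R by rewrite mulr_gt0// pi_gt0.
have m0 : (0 < m)%N.
  by rewrite lt0n; apply/eqP => m0; have := wa y; rewrite my m0 mulr0 ltxx.
have oW : open (U `&` f @^-1` V).
  by apply: openI => //; apply: open_comp.
have subfl (A B : set (surface v)) g : A `<=` B -> flat_on B g -> flat_on A g.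
  by move=> AB H d p /AB; exact: H.
have Wz : (U `&` f @^-1` V) z by [].
have near_root := flat_sub oW (subfl _ _ _ (@subIsetr _ _ _) (ff _ _ oV fe))
  (subfl _ _ _ (@subIsetl _ _ _) fz) Wz.
have [inv [invK inv_cts inv_near]] := open_embedding_inverse oU ez Uz.
have near_inv (P : set (surface v)) : (\forall x \near z, P x) ->
    \forall c \near zeta z, P (inv c).
  by move=> Pz; apply: (inv_cts _ Uz); rewrite invK.
pose g (c : C) := eta (f (inv c)).
exists g; split; last first.
  by apply: filterS (open_nbhs_nbhs (conj oU Uz)) => u Uu; rewrite /g invK.
have g_cts u : U u -> V (f u) -> {for zeta u, continuous g}.
  move=> Uu Vfu; apply: (@continuous_comp C (surface v) C inv (eta \o f)).
    exact: inv_cts.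
  rewrite invK//; apply: continuous_comp; first exact: cf.
  by have [+ _ _] := ee; apply; rewrite inE.
have gm : \forall c \near zeta z, g c ^+ m = c ^+ k + (eta (f z) ^+ m - zeta z ^+ k).
  have := near_inv _ near_root; apply: filterS2 (inv_near _ Uz) => c [_ cE].
  by rewrite /= cE => <-; rewrite addrC subrK.
have gmd : derivable (fun c => g c ^+ m) (zeta z) 1.
  refine (@near_derivable C _ _ _ _ (@derivable_exp_add C k (eta (f z) ^+ m - zeta z ^+ k) (zeta z))).
  by apply: filterS gm => c ->.
have gz : g (zeta z) = eta (f z) by rewrite /g invK.
(* Away from the zeros of eta o f, any root of a holomorphic function will do. *)
have [efz|efz] := eqVneq (eta (f z)) 0; last first.
  by apply: (derivable_root m0 (g_cts _ Uz Vfz) _ gmd); rewrite gz.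
have fzy : f z = y.
  by have [_ + _] := ee; apply; rewrite ?inE// ey.
(* At a zero of eta o f, the image f z is the centre y of its chart. *)
have [zx0|zx0] := pselect (z = x).
  have zz : zeta z = 0 by rewrite zx0.
  rewrite zz; apply: (@derivable_root0 R m k).
    rewrite m0/= -(ler_nat R) -(ler_pM2l twopi0) -my -kx -fzy -zx0.
    exact: fa.
  rewrite -zz; near=> c; split; last first.
    have -> : g c ^+ m = c ^+ k + (eta (f z) ^+ m - zeta z ^+ k) by near: c.
    have k0 : (0 < k)%N.
      by rewrite lt0n; apply/eqP => k0; have := fa x; rewrite kx k0 mulr0 leNgt wa.
    by rewrite efz zz !expr0n !gtn_eqF// subrr addr0.
  have [Uc cE] : U (inv c) /\ zeta (inv c) = c by near: c; exact: inv_near.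
  rewrite -cE; apply: g_cts => //; near: c.
  by apply: (near_inv (f @^-1` V)); apply: cf; exact: open_nbhs_nbhs.
(* At a regular point z, the cone angle of y = f z is at most 2 pi. *)
have m1 : m = 1%N.
  have /Ureg zreg : (U `\ x) z by split.
  have : 2 * pi * m%:R <= 2 * pi * 1 :> R.
    by rewrite -my -fzy mulr1 -zreg; exact: fa.
  by rewrite ler_pM2l// lern1; case: (m) m0 => [|[]].
apply: near_derivable gmd; apply: filterE => c; by rewrite m1.
Unshelve. all: by end_near. Qed.

Lemma translation_of_flat v w (f : surface v -> surface w) :
  continuous f ->
  (forall V psi, open V -> flat_on V psi -> flat_on (f @^-1` V) (psi \o f)) ->
  translation_in_charts f.
Proof.
move=> cf ff U phi [oU _ fphi _] V psi [oV _ fpsi _] z Uz Vfz.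
have oW : open (U `&` f @^-1` V).
  by apply: openI => //; apply: open_comp.
exists (psi (f z) - phi z).
have := @flat_sub _ _ (psi \o f) phi oW _ _ z (conj Uz Vfz).
have subfl (A B : set (surface v)) g : A `<=` B -> flat_on B g -> flat_on A g.
  by move=> AB H d p /AB; exact: H.
move=> /(_ (subfl _ _ _ (@subIsetr _ _ _) (ff _ _ oV fpsi))
  (subfl _ _ _ (@subIsetl _ _ _) fphi)).
by apply: filterS => z' <- /=; rewrite addrC subrK.
Qed.

End FlatPullback.

(** * Cone angles *)

Definition set_size (T : choiceType) (A : set T) : nat :=
  size (finmap.enum_fset (fset_set A)).

Lemma fsum_const (R : realType) (T : choiceType) (A : set T) (a : R) :
  finite_set A -> \sum_(x \in A) a = a *+ set_size A.
Proof.
by move=> fA; rewrite fsbig_finite//= big_const_seq count_predT iter_addr_0.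
Qed.

(** Compares the numbers of copies which meet at a point and at its image: the
    maps in hs are the ways in which a copy below arises from one above. *)
Lemma set_size_le (T : choiceType) (A B : set T) (hs : seq (T -> T)) :
  finite_set A -> finite_set B ->
  (forall x, A x -> exists2 h, List.In h hs & exists2 y, B y & x = h y) ->
  (set_size A <= size hs * set_size B)%N.
Proof.
move=> fA fB H.
pose s := finmap.enum_fset (fset_set B).
have -> : (size hs * set_size B)%N = size [seq h y | h <- hs, y <- s].
  by rewrite size_allpairs.
apply: uniq_leq_size; first exact: finmap.fset_uniq.
move=> x; rewrite in_fset_set// => /set_mem/H[h + [y By ->]].
elim: {H} hs => //= k hs IH [->|/IH]; rewrite mem_cat.
  by rewrite map_f// /s in_fset_set//; exact: mem_set.
by move=> ->; rewrite orbT.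
Qed.

Section ConeAngle.
Context {R : realType}.
Local Notation C := (plane R).
Implicit Types (v : 'I_3 -> C) (i : 'I_3) (d : C -> C) (p q z : C).

Definition sheets v d p : set (C -> C) :=
  [set d' | dihedral v d' /\ pt v d' p = pt v d p].

Lemma finite_sheets v d p : finite_set (dihedral v) -> finite_set (sheets v d p).
Proof. by apply: sub_finite_set => d' []. Qed.

Lemma sheets_gt0 v d p : finite_set (dihedral v) -> dihedral v d ->
  (0 < set_size (sheets v d p))%N.
Proof.
move=> fv vd; rewrite -has_predT; apply/hasP; exists d => //.
by rewrite in_fset_set; [exact: mem_set|exact: finite_sheets].
Qed.

(** All representatives of a point have the same position p in the triangle, so
    they contribute equal angles. *)
Lemma cone_angle_pt v d p : finite_set (dihedral v) -> dihedral v d -> hull v p ->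
  cone_angle (pt v d p) = angle_at v p *+ set_size (sheets v d p).
Proof.
move=> fv vd vp; rewrite -fsum_const; last exact: finite_sheets.
pose h (d' : C -> C) : copies v :=
  existT _ (insubd (dihedral_id v) d') (insubd (hull_v0 v) p).
rewrite /cone_angle (reindex_fsbig h (sheets v d p)).
  by apply: eq_fsbigr => d' _; rewrite /h/= val_hull.
split.
- by move=> d' [vd' e]; rewrite /= -e.
- move=> d1 d2 /set_mem[v1 _] /set_mem[v2 _] /(congr1 (fun c : copies v => \val (projT1 c))).
  by rewrite /h/= !val_dihedral.
- move=> [e q]; rewrite /= -[LHS]/(surface_pt e q) pt_surface_pt => eq.
  have qp : \val q = p := pt_inj (set_valP e) vd (set_valP q) vp eq.
  exists (\val e); first by split; [exact: set_valP|rewrite -eq qp].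
  by rewrite /h -qp !valKd.
Qed.

End ConeAngle.

Section AngleAt.
Context {R : realType}.
Local Notation C := (plane R).
Implicit Types (u : 'I_3 -> C).

Lemma angle_at_vertex u i : injective u -> angle_at u (u i) = vertex_angle u i.
Proof.
move=> ui; rewrite /angle_at; case: pickP => [j /eqP/ui -> //|/(_ i)].
by rewrite eqxx.
Qed.

Lemma angle_at_side u i z : (forall j, z != u j) -> side u i z -> angle_at u z = pi.
Proof.
move=> zu si; rewrite /angle_at; case: pickP => [j|_]; first by rewrite (negPf (zu j)).
by case: asboolP => // -[]; exists i.
Qed.

Lemma angle_at_interior u z : (forall j, z != u j) -> (forall i, ~ side u i z) ->
  angle_at u z = 2 * pi.
Proof.
move=> zu si; rewrite /angle_at; case: pickP => [j|_]; first by rewrite (negPf (zu j)).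
by case: asboolP => // -[i /si].
Qed.

End AngleAt.

(** * Coordinates adapted to the axis of symmetry *)

Section Barycentric.
Context {R : realType}.
Local Notation C := (plane R).
Context (u : 'I_3 -> C) (bary : C -> 'I_3 -> R).
Context (bary_sum : forall z, \sum_i bary z i = 1)
  (bary_comb : forall z, z = \sum_i (bary z i)%:C%C * u i)
  (bary_uniq : forall t : 'I_3 -> R, \sum_i t i = 1 ->
     forall i, bary (\sum_i (t i)%:C%C * u i) i = t i).

Lemma bary_hullP z : hull u z <-> forall i, 0 <= bary z i.
Proof.
split=> [[t [t0 t1 ->]] i|H]; first by rewrite bary_uniq.
by exists (bary z); split.
Qed.

Lemma bary_sideP i z : side u i z <-> hull u z /\ bary z i = 0.
Proof.
split=> [[t [t0 t1 ti ->]]|[/bary_hullP H zi]].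
  by split; [exists t|rewrite bary_uniq].
by exists (bary z); split.
Qed.

End Barycentric.

Section Fold.
Context {R : realType}.
Local Notation C := (plane R).
(** The right triangle w has its right angle at 0, its base angle at the vertex
    kb and its third vertex kc at the apex of the isosceles triangle.  Which of
    1 and - 1 is kb is left open, because each leg of w serves as the axis of
    one of the two isosceles triangles. *)
Context (b : C) (lam : R) (b0 : b != 0) (lam0 : lam != 0).
Context (w : 'I_3 -> C) (kb kc : 'I_3).
Let apex : C := b * ('i%C * lam%:C%C).
Context (kbc : kb = 1 /\ kc = -1 \/ kb = -1 /\ kc = 1)
  (w0 : w 0 = 0) (wb : w kb = b) (wc : w kc = apex).
Implicit Types (d : C -> C) (p q z : C).

(** The base runs from - b to b, so its midpoint is the origin, and the apex
    i lam b lies on the perpendicular bisector of the base. *)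
Definition isosceles : 'I_3 -> C :=
  fun i => if i == 0 then apex else if i == 1 then b else - b.
Local Notation v := isosceles.

(** Coordinates with respect to the legs b and apex of the right triangle. *)
Definition xc z : R := complex.Re (z / b).
Definition yc z : R := complex.Im (z / b) / lam.

Lemma coordE z : z = (xc z)%:C%C * b + (yc z)%:C%C * apex.
Proof.
rewrite /apex /xc /yc; set r := z / b.
have -> : z = r * b by rewrite mulfVK.
case: r => x y /=.
have -> : (x +i* y)%C = x%:C%C + 'i%C * (lam%:C%C * (y / lam)%:C%C) :> C.
  by apply/eqP; rewrite eq_complex/=; apply/andP; split; apply/eqP; field.
by ring.
Qed.

Lemma coord_comb (x y : R) :
  xc (x%:C%C * b + y%:C%C * apex) = x /\ yc (x%:C%C * b + y%:C%C * apex) = y.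
Proof.
rewrite /xc /yc (_ : _ / b = (x +i* (y * lam))%C).
  by rewrite /= mulfK.
have -> : (x +i* (y * lam))%C = x%:C%C + 'i%C * (lam%:C%C * y%:C%C) :> C.
  by apply/eqP; rewrite eq_complex/=; apply/andP; split; apply/eqP; field.
by rewrite /apex; field.
Qed.

Lemma xc_cts : continuous xc.
Proof.
move=> z; apply: (@continuous_comp C C R (fun z => z / b)); last exact: re_continuous.
exact: mulrr_continuous.
Qed.

Lemma yc_cts : continuous yc.
Proof.
move=> z; apply: (@continuousM R C (fun z => complex.Im (z / b)) (fun=> lam^-1)); last exact: cst_continuous.
apply: (@continuous_comp C C R (fun z => z / b)); last exact: im_continuous.
exact: mulrr_continuous.
Qed.

(** Case analysis on the vertices of w by their roles: right angle, base angle
    and half apex angle. *)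
Lemma ord3_ind_bc (P : 'I_3 -> Prop) : P 0 -> P kb -> P kc -> forall k, P k.
Proof. by move=> P0; case: kbc => -[-> ->] P1 P2; exact: ord3_ind. Qed.

Lemma kb0 : kb != 0. Proof. by case: kbc => -[-> _]. Qed.
Lemma kc0 : kc != 0. Proof. by case: kbc => -[_ ->]. Qed.
Lemma kcb : kc != kb. Proof. by case: kbc => -[-> ->]. Qed.

Lemma sum_ord3_bc (V : nmodType) (F : 'I_3 -> V) : \sum_i F i = F 0 + F kb + F kc.
Proof. by rewrite sum_ord3; case: kbc => -[-> ->]//; rewrite addrAC. Qed.

Definition bary_w z (i : 'I_3) : R :=
  if i == 0 then 1 - xc z - yc z else if i == kb then xc z else yc z.

Definition bary_v z (i : 'I_3) : R :=
  if i == 0 then yc z else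
  if i == 1 then (1 + xc z - yc z) / 2 else (1 - xc z - yc z) / 2.

Lemma bary_wE z : [/\ bary_w z 0 = 1 - xc z - yc z, bary_w z kb = xc z & bary_w z kc = yc z].
Proof.
by rewrite /bary_w !eqxx (negPf kb0) (negPf kc0) (negPf kcb).
Qed.

Lemma bary_vE z : [/\ bary_v z 0 = yc z, bary_v z 1 = (1 + xc z - yc z) / 2
  & bary_v z (-1) = (1 - xc z - yc z) / 2].
Proof. by []. Qed.

Lemma vE : [/\ v 0 = apex, v 1 = b & v (-1) = - b]. Proof. by []. Qed.

Lemma bary_w_sum z : \sum_i bary_w z i = 1.
Proof. by rewrite sum_ord3_bc; have [-> -> ->] := bary_wE z; ring. Qed.

Lemma bary_w_comb z : z = \sum_i (bary_w z i)%:C%C * w i.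
Proof.
rewrite sum_ord3_bc; have [-> -> ->] := bary_wE z; rewrite w0 wb wc mulr0 add0r.
exact: coordE.
Qed.

Lemma bary_w_uniq (t : 'I_3 -> R) : \sum_i t i = 1 ->
  forall i, bary_w (\sum_i (t i)%:C%C * w i) i = t i.
Proof.
move=> t1; rewrite sum_ord3_bc w0 wb wc mulr0 add0r.
have [e1 e2] := coord_comb (t kb) (t kc).
apply: ord3_ind_bc; rewrite /bary_w ?eqxx ?(negPf kb0) ?(negPf kc0) ?(negPf kcb) ?e1 ?e2//.
by rewrite -t1 sum_ord3_bc; ring.
Qed.

Lemma bary_v_sum z : \sum_i bary_v z i = 1.
Proof. by rewrite sum_ord3; have [-> -> ->] := bary_vE z; field. Qed.

Lemma bary_v_comb z : z = \sum_i (bary_v z i)%:C%C * v i.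
Proof.
rewrite sum_ord3; have [-> -> ->] := bary_vE z; have [-> -> ->] := vE.
rewrite [LHS]coordE mulrN -addrA -mulrBl -rmorphB addrC; congr (_ + _%:C%C * _).
by field.
Qed.

Lemma bary_v_uniq (t : 'I_3 -> R) : \sum_i t i = 1 ->
  forall i, bary_v (\sum_i (t i)%:C%C * v i) i = t i.
Proof.
move=> t1; rewrite sum_ord3; have [-> -> ->] := vE.
rewrite mulrN -addrA -mulrBl -rmorphB addrC/=.
have [e1 e2] := coord_comb (t 1 - t (-1)) (t 0).
move: t1; rewrite sum_ord3 => t1.
apply: ord3_ind; rewrite /bary_v /= ?e1 ?e2//.
  by move: t1; lra.
by move: t1; lra.
Qed.

Lemma hull_wP z : hull w z <-> [/\ 0 <= xc z, 0 <= yc z & xc z + yc z <= 1].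
Proof.
rewrite (bary_hullP bary_w_sum bary_w_comb bary_w_uniq).
have [e0 e1 e2] := bary_wE z; split=> [H|[H1 H2 H3]].
  by move: (H 0) (H kb) (H kc); rewrite e0 e1 e2; split=> //; lra.
by apply: ord3_ind_bc; rewrite ?e0 ?e1 ?e2//; lra.
Qed.

Lemma hull_vP z : hull v z <-> [/\ 0 <= yc z, xc z + yc z <= 1 & yc z - xc z <= 1].
Proof.
rewrite (bary_hullP bary_v_sum bary_v_comb bary_v_uniq).
have [e0 e1 e2] := bary_vE z; split=> [H|[H1 H2 H3]].
  by move: (H 0) (H 1) (H (-1)); rewrite e0 e1 e2; split=> //; lra.
by apply: ord3_ind; rewrite ?e0 ?e1 ?e2//; lra.
Qed.

Lemma side_w0 z : side w 0 z <-> hull w z /\ xc z + yc z = 1.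
Proof.
rewrite (bary_sideP bary_w_sum bary_w_comb bary_w_uniq).
by have [-> _ _] := bary_wE z; split=> -[? ?]; split=> //; lra.
Qed.
Lemma side_wb z : side w kb z <-> hull w z /\ xc z = 0.
Proof.
by rewrite (bary_sideP bary_w_sum bary_w_comb bary_w_uniq); have [_ -> _] := bary_wE z.
Qed.
Lemma side_wc z : side w kc z <-> hull w z /\ yc z = 0.
Proof.
by rewrite (bary_sideP bary_w_sum bary_w_comb bary_w_uniq); have [_ _ ->] := bary_wE z.
Qed.
Lemma side_v0 z : side v 0 z <-> hull v z /\ yc z = 0.
Proof. exact: (bary_sideP bary_v_sum bary_v_comb bary_v_uniq). Qed.
Lemma side_v1 z : side v 1 z <-> hull v z /\ yc z - xc z = 1.
Proof.
rewrite (bary_sideP bary_v_sum bary_v_comb bary_v_uniq).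
by have [_ -> _] := bary_vE z; split=> -[? ?]; split=> //; lra.
Qed.
Lemma side_v2 z : side v (-1) z <-> hull v z /\ xc z + yc z = 1.
Proof.
rewrite (bary_sideP bary_v_sum bary_v_comb bary_v_uniq).
by have [_ _ ->] := bary_vE z; split=> -[? ?]; split=> //; lra.
Qed.

(** * The reflections and the two dihedral groups *)

(** The map z |-> axis * z^* is the reflection in the line through 0 and b, the
    base of the isosceles triangle. *)
Definition axis : C := b / b^*.
(** The rotation by twice the base angle: the product of the reflections in the
    hypotenuse and in the base. *)
Definition omega : C := (1 - 'i%C * lam%:C%C) / (1 + 'i%C * lam%:C%C).
(** The reflections in the axis of symmetry, the base and the hypotenuse: [rho],
    [sigma] and [tau]. *)
Definition rho z : C := - (axis * z^*).
Definition sigma z : C := axis * z^*.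
Definition tau z : C := omega * axis * z^*.

Let bJ0 : b^* != 0. Proof. by rewrite conjC_eq0. Qed.

Lemma axis0 : axis != 0.
Proof. by rewrite mulf_neq0 ?invr_eq0. Qed.

Lemma axisJ : axis^* = axis^-1.
Proof. by rewrite /axis rmorphM/= fmorphV/= conjCK invfM invrK mulrC. Qed.

Lemma ilam_neq0 : (1 - 'i%C * lam%:C%C != 0 :> C) /\ (1 + 'i%C * lam%:C%C != 0 :> C).
Proof.
split; rewrite eq_complex/= negb_and; apply/orP; left;
  rewrite !(mul0r, mul1r, mulr0, oppr0, addr0, subr0, subrr) oner_eq0//.
Qed.

Lemma omega0 : omega != 0.
Proof. by have [? ?] := ilam_neq0; rewrite mulf_neq0// invr_eq0. Qed.

Lemma omegaJ : omega^* = omega^-1.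
Proof.
rewrite /omega invfM invrK mulrC rmorphM/= fmorphV/= rmorphB rmorphD rmorph1 rmorphM/=.
by rewrite conj_real conj_i mulNr opprK.
Qed.

Lemma rhoK z : rho (rho z) = z.
Proof.
by rewrite /rho rmorphN/= rmorphM/= conjCK axisJ mulrN opprK mulrA divff ?mul1r ?axis0.
Qed.

Lemma tauK z : tau (tau z) = z.
Proof.
rewrite /tau 2!rmorphM/= conjCK axisJ omegaJ mulrA mulrACA divff ?omega0// divff ?axis0//.
by rewrite !mul1r.
Qed.

Lemma tau_rho z : tau (rho z) = - (omega * z).
Proof.
rewrite /tau /rho rmorphN/= (rmorphM _ axis)/= conjCK axisJ mulrN -mulrA.
by rewrite (mulrA axis) divff ?axis0// mul1r.
Qed.

Lemma sigma_rho z : sigma (rho z) = rho (sigma z).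
Proof. by rewrite /sigma /rho rmorphN/= mulrN. Qed.

Lemma refl_w0 : reflection w 0 = tau.
Proof.
apply/funext => z; rewrite /reflection /tau; congr (_ * _).
have -> : omega * axis = (apex - b) / (apex - b)^*.
  rewrite /apex /omega /axis rmorphB !rmorphM/= conj_real conj_i.
  have [h1 h2] := ilam_neq0.
  have h3 : b^* * (- 'i%C * lam%:C%C) - b^* != 0.
    rewrite (_ : _ - _ = - (b^* * (1 + 'i%C * lam%:C%C))); last by ring.
    by rewrite oppr_eq0 mulf_neq0.
  by field; rewrite h3 bJ0 h2.
have [e1 e2 e3 e4] := ord3E; rewrite e1 add0r.
move: wb wc; case: kbc => -[-> ->] -> ->//.
by rewrite -[b - apex]opprB rmorphN/= invrN mulrNN.
Qed.

Lemma refl_wb : reflection w kb = rho.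
Proof.
apply/funext => z; rewrite /reflection /rho -mulNr; congr (_ * _).
have -> : - axis = apex / apex^*.
  rewrite /apex /axis !rmorphM/= conj_real conj_i.
  have lC0 : lam%:C%C != 0 :> C by rewrite eq_complex/= negb_and lam0.
  by field; rewrite neq0Ci lC0 bJ0.
have [e1 e2 e3 e4] := ord3E.
move: wb wc; case: kbc => -[-> ->] _ wc'; rewrite ?subrr ?e2 ?e3 ?e4 w0 wc' ?subr0//.
by rewrite sub0r rmorphN/= invrN mulrNN.
Qed.

Lemma refl_wc : reflection w kc = sigma.
Proof.
apply/funext => z; rewrite /reflection /sigma; congr (_ * _).
have [e1 e2 e3 e4] := ord3E.
move: wb wc; case: kbc => -[-> ->] wb' _; rewrite ?subrr ?e2 ?e3 ?e4 w0 wb' ?subr0//.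
by rewrite sub0r rmorphN/= invrN mulrNN.
Qed.

Lemma refl_v0 : reflection v 0 = sigma.
Proof.
apply/funext => z; rewrite /reflection /sigma; congr (_ * _).
have [e1 e2 e3 e4] := ord3E; have [_ v1 v2] := vE; rewrite e1 add0r v1 v2.
rewrite (_ : - b - b = (- 2)%:C%C * b) ?axis_scale// ?oppr_eq0 ?pnatr_eq0//.
by rewrite rmorphN/= rmorph_nat; ring.
Qed.

Lemma refl_v2 : reflection v (-1) = tau.
Proof.
rewrite -refl_w0; apply/funext => z; rewrite /reflection; congr (_ * _).
have [e1 e2 e3 e4] := ord3E; have [v0 v1 v2] := vE; rewrite e1 e3 e4 add0r v0 v1.
move: wb wc; case: kbc => -[-> ->] -> ->//.
by rewrite -[b - apex]opprB rmorphN/= invrN mulrNN.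
Qed.

(** The left equal side is the mirror image of the hypotenuse in the axis of
    symmetry, so its reflection is the conjugate of tau by rho. *)
Lemma refl_v1 : reflection v 1 = rho \o tau \o rho.
Proof.
apply/funext => z; rewrite /= tau_rho /rho rmorphN/= (rmorphM _ omega)/= omegaJ.
rewrite mulrN opprK mulrA /reflection; congr (_ * _).
have [e1 e2 e3 e4] := ord3E; have [v0 v1 v2] := vE; rewrite e2 subrr v0 v2.
have [h1 h2] := ilam_neq0.
rewrite /apex /omega /axis opprK invfM invrK rmorphD !rmorphM/= conj_real conj_i.
have h3 : b^* * (- 'i%C * lam%:C%C) + b^* != 0.
  rewrite (_ : _ + _ = b^* * (1 - 'i%C * lam%:C%C)); last by ring.
  by rewrite mulf_neq0.
by field; rewrite ?h3 ?bJ0 ?h1 ?h2 ?b0.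
Qed.

Lemma xc_rho z : xc (rho z) = - xc z.
Proof.
rewrite /xc /rho /axis (_ : _ / b = - (z / b)^*); last first.
  by rewrite rmorphM/= fmorphV/=; field; rewrite bJ0.
by case: (z / b).
Qed.

Lemma yc_rho z : yc (rho z) = yc z.
Proof.
rewrite /yc /rho /axis (_ : _ / b = - (z / b)^*); last first.
  by rewrite rmorphM/= fmorphV/=; field; rewrite bJ0.
by case: (z / b) => x y /=; rewrite opprK.
Qed.

Lemma rho_cts : continuous rho.
Proof.
have -> : rho = (fun z : C => - axis * z) \o (fun z : C => z^*).
  by apply/funext => z; rewrite /rho/= mulNr.
move=> z; apply: continuous_comp; first exact: conj_continuous.
exact: mulrl_continuous.
Qed.

Lemma rho_fix z : xc z = 0 -> rho z = z.
Proof.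
move=> z0; rewrite [LHS]coordE [RHS]coordE xc_rho yc_rho z0 oppr0//.
Qed.

Lemma dih_w_rho d : dihedral w d -> dihedral w (d \o rho).
Proof. by rewrite -refl_wb; exact: dihedralM. Qed.
Lemma dih_w_tau d : dihedral w d -> dihedral w (d \o tau).
Proof. by rewrite -refl_w0; exact: dihedralM. Qed.
Lemma dih_w_sigma d : dihedral w d -> dihedral w (d \o sigma).
Proof. by rewrite -refl_wc; exact: dihedralM. Qed.
Lemma dih_v_tau d : dihedral v d -> dihedral v (d \o tau).
Proof. by rewrite -refl_v2; exact: dihedralM. Qed.
Lemma dih_v_sigma d : dihedral v d -> dihedral v (d \o sigma).
Proof. by rewrite -refl_v0; exact: dihedralM. Qed.
Lemma dih_v_conj d : dihedral v d -> dihedral v (d \o (rho \o tau \o rho)).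
Proof. by rewrite -refl_v1; exact: dihedralM. Qed.

Lemma comp_rhoK d : d \o rho \o rho = d.
Proof. by apply/funext => z /=; rewrite rhoK. Qed.

Lemma comp_sigma_rho d : d \o rho \o sigma = d \o sigma \o rho.
Proof. by apply/funext => z /=; rewrite sigma_rho. Qed.

(** Crossing the left equal side in the left half of d . v amounts to crossing
    the hypotenuse of (d rho) . w. *)
Lemma comp_conj d : d \o rho \o (rho \o tau \o rho) = d \o tau \o rho.
Proof. by apply/funext => z /=; rewrite rhoK. Qed.

Lemma dih_v_w d : dihedral v d -> dihedral w d.
Proof.
elim=> [|{}d i _ wd]; first exact: dihedral1.
elim/ord3_ind: i; rewrite ?refl_v0 ?refl_v1 ?refl_v2.
- exact: dih_w_sigma.
- exact: (dih_w_rho (dih_w_tau (dih_w_rho wd))).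
- exact: dih_w_tau.
Qed.

(** The set of d which satisfy the conclusion contains the identity and is
    stable under the three reflections of w: rho exchanges the two alternatives,
    and rho tau rho and sigma are reflections of v. *)
Lemma dih_w_v d : dihedral w d -> dihedral v d \/ dihedral v (d \o rho).
Proof.
elim=> [|{}d i _]; first by left; exact: dihedral1.
elim/ord3_ind_bc: i; rewrite ?refl_w0 ?refl_wb ?refl_wc => -[vd|vd].
- by left; exact: dih_v_tau.
- by right; rewrite -comp_conj; exact: dih_v_conj.
- by right; rewrite comp_rhoK.
- by left.
- by left; exact: dih_v_sigma.
- by right; rewrite -comp_sigma_rho; exact: dih_v_sigma.
Qed.

Lemma hull_w_v z : hull w z -> hull v z.
Proof. by move=> /hull_wP[? ? ?]; apply/hull_vP; split=> //; lra. Qed.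

Lemma hull_w_rho z : hull w z -> hull v (rho z).
Proof.
by move=> /hull_wP[? ? ?]; apply/hull_vP; rewrite xc_rho yc_rho; split=> //; lra.
Qed.

Lemma hull_v_w z : hull v z -> 0 <= xc z -> hull w z.
Proof. by move=> /hull_vP[? ? ?] ?; apply/hull_wP; split=> //; lra. Qed.

Lemma hull_v_rho z : hull v z -> xc z <= 0 -> hull w (rho z).
Proof.
by move=> /hull_vP[? ? ?] ?; apply/hull_wP; rewrite xc_rho yc_rho; split=> //; lra.
Qed.

Lemma hull_rho z : hull v z -> hull v (rho z).
Proof.
by move=> /hull_vP[? ? ?]; apply/hull_vP; rewrite xc_rho yc_rho; split=> //; lra.
Qed.

(** * The fold *)

(** The points of the isosceles surface which should lie above the point q of
    d . w: the same q in d . v, or its mirror image in (d rho) . v, whenever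
    these copies exist. *)
Definition lift d q (x : surface v) : Prop :=
  (dihedral v d /\ x = pt v d q) \/
  (dihedral v (d \o rho) /\ x = pt v (d \o rho) (rho q)).

(** Lifting of gluings: crossing a side of w below is followed above by crossing
    the hypotenuse, its mirror image, the base, or the axis inside one copy. *)
Lemma lift_glue d q x i : lift d q x -> side w i q -> lift (d \o reflection w i) q x.
Proof.
elim/ord3_ind_bc: i; rewrite ?refl_w0 ?refl_wb ?refl_wc => -[[vd ->]|[vd ->]].
- move=> /side_w0[/hull_w_v vq q1]; left; split; first exact: dih_v_tau.
  by rewrite -refl_v2; apply: pt_glue => //; apply/side_v2.
- move=> /side_w0[/hull_w_rho vq q1]; right; rewrite -comp_conj.
  split; first exact: dih_v_conj.
  rewrite -refl_v1; apply: pt_glue => //; apply/side_v1; split=> //.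
  by rewrite xc_rho yc_rho -q1; ring.
- move=> /side_wb[_ q0]; right; rewrite comp_rhoK; split=> //.
  by rewrite rho_fix.
- by move=> /side_wb[_ q0]; left; split=> //; rewrite rho_fix.
- move=> /side_wc[/hull_w_v vq q1]; left; split; first exact: dih_v_sigma.
  by rewrite -refl_v0; apply: pt_glue => //; apply/side_v0.
- move=> /side_wc[/hull_w_rho vq q1]; right; rewrite -comp_sigma_rho.
  split; first exact: dih_v_sigma.
  rewrite -refl_v0; apply: pt_glue => //; apply/side_v0; split=> //.
  by rewrite yc_rho.
Qed.

Lemma reflK_w i : reflection w i \o reflection w i = id.
Proof.
elim/ord3_ind_bc: i; rewrite ?refl_w0 ?refl_wb ?refl_wc; apply/funext => z /=.
- exact: tauK.
- exact: rhoK.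
- have := rhoK z; rewrite /rho /sigma rmorphN/= mulrN opprK; exact.
Qed.

Lemma comp_reflK_w d i : d \o reflection w i \o reflection w i = d.
Proof. by rewrite -compA reflK_w. Qed.

Lemma lift_pt d d' q q' x : dihedral w d -> dihedral w d' -> hull w q ->
  hull w q' -> pt w d q = pt w d' q' -> lift d q x -> lift d' q' x.
Proof.
move=> wd wd' wq wq'.
apply: (pt_eq_ind (P := fun d q => lift d q x)) => // e i p we wi.
split=> [l|/lift_glue/(_ wi)]; first exact: lift_glue.
by rewrite comp_reflK_w.
Qed.

(** On the right half the fold is the identity and on the left half the
    reflection in the axis, with the copy changed accordingly. *)
Lemma fold_exists : exists f : surface v -> surface w,
  forall d q x, hull w q -> lift d q x -> f x = pt w d q.
Proof.
(* On the axis both formulas agree, by the gluing along the side opposite to kb. *)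
pose F d p := if 0 <= xc p then pt w d p else pt w (d \o rho) (rho p).
have F0 d p : 0 <= xc p -> F d p = pt w d p by rewrite /F => ->.
have F1 d p : dihedral v d -> hull v p -> xc p <= 0 -> F d p = pt w (d \o rho) (rho p).
  move=> vd vp; rewrite /F; case: ifPn => // p0 p0'.
  have px : xc p = 0 by apply/eqP; rewrite eq_le p0 p0'.
  rewrite (rho_fix px) -refl_wb; apply: pt_glue; first exact: dih_v_w.
  by apply/side_wb; split=> //; exact: hull_v_w.
have [|f fE] := @pt_rec R v _ F.
  move=> d i p vd si.
  have vdi : dihedral v (d \o reflection v i) by exact: dihedralM.
  have vp := side_hull si; have wd := dih_v_w vd.
  elim/ord3_ind: i si vdi => [/side_v0[_ p0]|/side_v1[_ p0]|/side_v2[_ p0]] vdi.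
  - have [px|/ltW px] := leP 0 (xc p).
      rewrite !F0// refl_v0 -refl_wc; apply: pt_glue => //; apply/side_wc; split=> //.
      exact: hull_v_w.
    rewrite !F1// refl_v0 -comp_sigma_rho.
    rewrite -refl_wc; apply: pt_glue; first exact: dih_w_rho.
    by apply/side_wc; rewrite yc_rho; split=> //; exact: hull_v_rho.
  - have px : xc p <= 0 by move: vp => /hull_vP[]; lra.
    rewrite !F1// refl_v1.
    rewrite (_ : d \o _ \o _ = d \o rho \o tau); last first.
      by apply/funext => z /=; rewrite rhoK.
    rewrite -refl_w0; apply: pt_glue; first exact: dih_w_rho.
    apply/side_w0; rewrite xc_rho yc_rho; split; first exact: hull_v_rho.
    by rewrite -p0 addrC.
  - have px : 0 <= xc p by move: vp => /hull_vP[]; lra.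
    rewrite !F0// refl_v2 -refl_w0; apply: pt_glue => //; apply/side_w0; split=> //.
    exact: hull_v_w.
exists f => d q x wq [[vd ->]|[vd ->]].
  by rewrite fE ?F0//; [move: wq => /hull_wP[]|exact: hull_w_v].
rewrite fE// ?F1//; try exact: hull_w_rho.
  by rewrite comp_rhoK rhoK.
by rewrite xc_rho oppr_le0; move: wq => /hull_wP[].
Qed.

Section FoldMap.
Context (f : surface v -> surface w)
  (fE : forall d q x, hull w q -> lift d q x -> f x = pt w d q).

Lemma fold_right d p : dihedral v d -> hull v p -> 0 <= xc p ->
  f (pt v d p) = pt w d p.
Proof. by move=> vd vp px; apply: fE; [exact: hull_v_w|left]. Qed.

Lemma fold_left d p : dihedral v d -> hull v p -> xc p <= 0 ->
  f (pt v d p) = pt w (d \o rho) (rho p).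
Proof.
move=> vd vp px; apply: fE; first exact: hull_v_rho.
by right; rewrite comp_rhoK rhoK.
Qed.

Lemma lift_total x : exists d q, [/\ dihedral w d, hull w q & lift d q x].
Proof.
move: x; apply: surface_ind => d p vd vp; have [px|/ltW px] := leP 0 (xc p).
  by exists d, p; split; [exact: dih_v_w|exact: hull_v_w|left].
exists (d \o rho), (rho p); split; [exact/dih_w_rho/dih_v_w|exact: hull_v_rho|].
by right; rewrite comp_rhoK rhoK.
Qed.

(** Some representative of f x lifts to x, because every point is a lift; and the
    gluings which lead from it to any other representative lift as well. *)
Lemma fold_fiber d q x : dihedral w d -> hull w q -> f x = pt w d q -> lift d q x.
Proof.
have [d' [q' [wd' wq' l]]] := lift_total x.
rewrite (fE wq' l) => wd wq /lift_pt; exact.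
Qed.

Lemma fold_surj : range f = setT.
Proof.
apply/seteqP; split=> // y _; move: y; apply: surface_ind => d q wd wq.
case: (dih_w_v wd) => vd.
  by exists (pt v d q) => //; apply: fE => //; left.
by exists (pt v (d \o rho) (rho q)) => //; apply: fE => //; right.
Qed.

Lemma fold_finite_fiber y : finite_set (f @^-1` [set y]).
Proof.
move: y; apply: surface_ind => d q wd wq.
apply: (@sub_finite_set _ _ [set pt v d q; pt v (d \o rho) (rho q)]).
  by move=> x /= /(fold_fiber wd wq)[[_ ->]|[_ ->]]; [left|right].
exact: finite_set2.
Qed.

(** Local statements about the fold at p are checked on the two closed halves
    separately; a half which does not contain p is avoided near p. *)
Lemma near_fold (P : (C -> C) -> C -> Prop) d p :
  (0 <= xc p -> \forall q \near p, hull w q -> P d q) ->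
  (xc p <= 0 -> \forall q \near rho p, hull w q -> P (d \o rho) q) ->
  \forall q \near p, hull v q ->
    (0 <= xc q -> P d q) /\ (xc q <= 0 -> P (d \o rho) (rho q)).
Proof.
move=> H1 H2.
have {}H1 : \forall q \near p, 0 <= xc q -> hull w q -> P d q.
  have [px|px] := leP 0 (xc p); first by apply: filterS (H1 px) => q + _.
  have : \forall q \near p, xc q < 0 by exact: (@cvgr_lt R C (nbhs p) _ xc _ (@xc_cts p) _ px).
  by apply: filterS => q q0; rewrite leNgt q0.
have {}H2 : \forall q \near p, xc q <= 0 -> hull w (rho q) -> P (d \o rho) (rho q).
  have [px|px] := leP (xc p) 0.
    have : \forall q \near p, hull w (rho q) -> P (d \o rho) (rho q).
      exact: (@rho_cts p _ (H2 px)).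
    by apply: filterS => q Hq _; exact: Hq.
  have : \forall q \near p, 0 < xc q by exact: (@cvgr_gt R C (nbhs p) _ xc _ (@xc_cts p) _ px).
  by apply: filterS => q q0; rewrite leNgt q0.
apply: filterS2 H1 H2 => q H1 H2 vq; split=> q0.
  by apply: H1 => //; exact: hull_v_w.
by apply: H2 => //; exact: hull_v_rho.
Qed.

Lemma fold_continuous : continuous f.
Proof.
apply/continuousP => V /open_surfaceP oV; apply/open_surfaceP => d p vd vp Vfp.
have wd := dih_v_w vd; have wd' := dih_w_rho wd.
have := @near_fold (fun e q => V (pt w e q)) d p; rewrite /= => /(_ _ _)/wrap[].
- move=> p0; apply: oV => //; first exact: hull_v_w.
  by rewrite -fold_right.
- move=> p0; apply: oV => //; first exact: hull_v_rho.
  by rewrite -fold_left.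
apply: filterS => q H vq; have [H1 H2] := H vq; rewrite /=.
have [q0|/ltW q0] := leP 0 (xc q).
  by rewrite fold_right//; exact: H1.
by rewrite fold_left//; exact: H2.
Qed.

(** On the left half the fold reads (d rho) (rho q) = d q, so the coordinate of
    the copy is preserved. *)
Lemma fold_flat V psi : open V -> flat_on V psi -> flat_on (f @^-1` V) (psi \o f).
Proof.
move=> oV /flat_onP fV; apply/flat_onP => d p vd vp Vfp.
have wd := dih_v_w vd; have wd' := dih_w_rho wd.
have := @near_fold (fun e q => psi (pt w e q) - e q = psi (f (pt v d p)) - d p) d p.
rewrite /= => /(_ _ _)/wrap[].
- move=> p0; rewrite fold_right//; apply: fV => //; first exact: hull_v_w.
  by rewrite -fold_right.
- move=> p0; rewrite fold_left//.
  have := fV _ _ wd' (hull_v_rho vp p0); rewrite -fold_left// => /(_ Vfp).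
  by rewrite /= rhoK.
apply: filterS => q H vq; have [H1 H2] := H vq; rewrite /=.
have [q0|/ltW q0] := leP 0 (xc q).
  by rewrite fold_right//; exact: H1.
by rewrite (fold_left vd vq q0) -(H2 q0) rhoK.
Qed.

(** The saturation of f W is described by the two lifts, each of which depends
    continuously on q. *)
Lemma fold_open W : open W -> open (f @` W).
Proof.
move=> /open_surfaceP oW; apply/open_surfaceP => d q wd wq [x Wx].
move=> /(fold_fiber wd wq)[[vd xE]|[vd xE]].
  move: Wx; rewrite xE => /(oW _ _ vd (hull_w_v wq)).
  apply: filterS => p Wp wp; exists (pt v d p); first exact: (Wp (hull_w_v wp)).
  by apply: fE => //; left.
move: Wx; rewrite xE => /(oW _ _ vd (hull_w_rho wq)) oWr.
have : \forall p \near q, hull v (rho p) -> W (pt v (d \o rho) (rho p)).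
  exact: (@rho_cts q _ oWr).
apply: filterS => p Wp wp; exists (pt v (d \o rho) (rho p)).
  exact: (Wp (hull_w_rho wp)).
by apply: fE => //; right.
Qed.

(** * Cone angles under the fold *)

Lemma coord_inj z z' : xc z = xc z' -> yc z = yc z' -> z = z'.
Proof. by move=> ex ey; rewrite [LHS]coordE [RHS]coordE ex ey. Qed.

Lemma coord_vertices : [/\ xc 0 = 0 /\ yc 0 = 0, xc b = 1 /\ yc b = 0,
  xc (- b) = -1 /\ yc (- b) = 0 & xc apex = 0 /\ yc apex = 1].
Proof.
split.
- by have := coord_comb 0 0; rewrite !mul0r addr0.
- by have := coord_comb 1 0; rewrite mul0r mul1r addr0.
- by have := coord_comb (-1) 0; rewrite mul0r rmorphN1 mulN1r addr0.
- by have := coord_comb 0 1; rewrite mul0r mul1r add0r.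
Qed.

Lemma w_inj : injective w.
Proof.
have [[x0 y0] [xb yb] _ [xa ya]] := coord_vertices.
move=> i j e; have ex := congr1 xc e; have ey := congr1 yc e.
move: {e} i ex ey; apply: ord3_ind_bc; move: j; apply: ord3_ind_bc => //;
  rewrite ?w0 ?wb ?wc ?x0 ?y0 ?xb ?yb ?xa ?ya => *; exfalso; lra.
Qed.

Lemma v_inj : injective v.
Proof.
have [[x0 y0] [xb yb] [xb' yb'] [xa ya]] := coord_vertices.
have [v0 v1 v2] := vE.
move=> i j e; have ex := congr1 xc e; have ey := congr1 yc e.
move: {e} i ex ey; apply: ord3_ind; move: j; apply: ord3_ind => //;
  rewrite ?v0 ?v1 ?v2 ?xb ?yb ?xb' ?yb' ?xa ?ya => *; exfalso; lra.
Qed.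

Context (aw0 : vertex_angle w 0 = pi / 2)
  (av0 : vertex_angle v 0 = 2 * vertex_angle w kc)
  (av1 : vertex_angle v 1 = vertex_angle w kb)
  (av2 : vertex_angle v (-1) = vertex_angle w kb)
  (awb_gt0 : 0 < vertex_angle w kb) (awc_gt0 : 0 < vertex_angle w kc).

(** Off the axis only one half of v contains the point. *)
Lemma angle_fold_off z : hull w z -> 0 < xc z ->
  angle_at v z = angle_at w z /\ angle_at v (rho z) = angle_at w z.
Proof.
move=> wz z0; have [x1 y1 xy1] := iffLR (hull_wP z) wz.
have vz := hull_w_v wz; have vrz := hull_w_rho wz.
have [[x0 y0] [xb yb] [xb' yb'] [xa ya]] := coord_vertices.
have [v0 v1 v2] := vE.
have [zb|zb] := eqVneq z b.
  have -> : rho z = - b.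
    by apply: coord_inj; rewrite zb ?xc_rho ?yc_rho ?xb ?yb ?xb' ?yb'.
  have := angle_at_vertex 1 v_inj; have := angle_at_vertex (-1) v_inj.
  have := angle_at_vertex kb w_inj; rewrite wb av1 av2 v1 v2 zb.
  by move=> -> -> ->.
have zw j : z != w j.
  move: j; apply: ord3_ind_bc; rewrite ?w0 ?wb ?wc//; apply/eqP => zE;
    by move: z0; rewrite zE ?x0 ?xa ltxx.
have zv j : z != v j.
  move: j; apply: ord3_ind; rewrite ?v0 ?v1 ?v2//; apply/eqP => zE;
    by move: z0; rewrite zE ?xa ?xb'; lra.
have rzv j : rho z != v j.
  move: j; apply: ord3_ind; rewrite ?v0 ?v1 ?v2//; apply/eqP => zE.
  - by have := congr1 xc zE; rewrite xc_rho xa; lra.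
  - by have := congr1 xc zE; rewrite xc_rho xb; lra.
  - have := congr1 rho zE; rewrite rhoK => zE'.
    by move/eqP: zb; apply; rewrite zE'; apply: coord_inj; rewrite ?xc_rho ?yc_rho ?xb ?yb ?xb' ?yb' ?opprK.
have [yz|yz] := eqVneq (yc z) 0.
  rewrite (angle_at_side zw (iffRL (side_wc z) _))//.
  rewrite (angle_at_side zv (iffRL (side_v0 z) _))//.
  by rewrite (angle_at_side rzv (iffRL (side_v0 _) _)) ?yc_rho.
have [hz|hz] := eqVneq (xc z + yc z) 1.
  rewrite (angle_at_side zw (iffRL (side_w0 z) _))//.
  rewrite (angle_at_side zv (iffRL (side_v2 z) _))//.
  rewrite (angle_at_side rzv (iffRL (side_v1 _) _)) ?yc_rho ?xc_rho//.
  by split=> //; lra.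
move/eqP: yz => yz; move/eqP: hz => hz.
rewrite !angle_at_interior//.
- apply: ord3_ind => [/side_v0[]|/side_v1[]|/side_v2[]]; rewrite ?xc_rho ?yc_rho//; lra.
- apply: ord3_ind_bc => [/side_w0[]|/side_wb[]|/side_wc[]]//; lra.
- apply: ord3_ind => [/side_v0[]|/side_v1[]|/side_v2[]]//; lra.
Qed.

(** On the axis the two halves of v meet, each contributing the angle of w: the
    right angle at 0 becomes a flat angle on the base, the half apex angle is
    doubled, and an interior point of the axis becomes an interior point of v. *)
Lemma angle_fold_axis z : hull w z -> xc z = 0 -> angle_at v z = 2 * angle_at w z.
Proof.
move=> wz z0; have [x1 y1 xy1] := iffLR (hull_wP z) wz.
have vz := hull_w_v wz.
have [[x0 y0] [xb yb] [xb' yb'] [xa ya]] := coord_vertices.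
have [v0 v1 v2] := vE.
have [za|za] := eqVneq z apex.
  have := angle_at_vertex 0 v_inj; have := angle_at_vertex kc w_inj.
  by rewrite wc av0 v0 za => -> ->.
have zv j : z != v j.
  move: j; apply: ord3_ind; rewrite ?v0 ?v1 ?v2//; apply/eqP => zE;
    by move: z0; rewrite zE ?xb ?xb'; lra.
have [z00|z00] := eqVneq z 0.
  rewrite (angle_at_side zv (iffRL (side_v0 z) _)); last by split=> //; rewrite z00.
  have := angle_at_vertex 0 w_inj; rewrite w0 aw0 z00 => ->; by field.
have zw j : z != w j.
  move: j; apply: ord3_ind_bc; rewrite ?w0 ?wb ?wc//; apply/eqP => zE;
    by move: z0; rewrite zE xb; lra.
rewrite (angle_at_side zw (iffRL (side_wb z) _))// angle_at_interior//.
apply: ord3_ind => [/side_v0[_ yz]|/side_v1[_ yz]|/side_v2[_ yz]].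
- by move/eqP: z00; apply; apply: coord_inj; rewrite ?x0 ?y0.
- by move/eqP: za; apply; apply: coord_inj; rewrite ?xa ?ya//; lra.
- by move/eqP: za; apply; apply: coord_inj; rewrite ?xa ?ya//; lra.
Qed.

Lemma angle_w_gt0 z : hull w z -> 0 < angle_at w z.
Proof.
move=> wz; rewrite /angle_at; case: pickP => [j _|_].
  by move: j; apply: ord3_ind_bc; rewrite ?aw0//; rewrite divr_gt0// pi_gt0.
by case: asboolP => _; rewrite ?mulr_gt0 ?pi_gt0.
Qed.

Context (finite_w : finite_set (dihedral w)).

Lemma finite_v : finite_set (dihedral v).
Proof. by apply: sub_finite_set finite_w => d; exact: dih_v_w. Qed.

Lemma cone_angle_w_gt0 (y : surface w) : 0 < cone_angle y.
Proof.
move: y; apply: surface_ind => d q wd wq; rewrite cone_angle_pt//.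
by rewrite pmulrn_lgt0 ?angle_w_gt0// sheets_gt0.
Qed.

(** The lifts of a copy which meets f x are copies which meet x.  Off the axis
    each copy below has its own copy above, with the same angle.  On the axis a
    copy above accounts for two copies below, d and d rho, but its angle is
    twice as large. *)
Lemma cone_angle_fold (x : surface v) : cone_angle (f x) <= cone_angle x.
Proof.
move: x; apply: surface_ind => d p vd vp; have wd := dih_v_w vd.
have fv := finite_v.
have [px|px] := leP 0 (xc p).
  have wp := hull_v_w vp px.
  rewrite fold_right// !cone_angle_pt//.
  have a0 := ltW (angle_w_gt0 wp).
  have fx e : sheets w d p e -> dihedral w e /\ lift e p (pt v d p).
    move=> [we /esym ep]; split=> //; apply: (lift_pt _ _ _ _ ep) => //; first by left.
  move: px; rewrite le_eqVlt => /predU1P[/esym px|px].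
    rewrite (angle_fold_axis wp px) mulr_natl -mulrnA; apply: ler_wpMn2l => //.
    (* A copy e below comes from the copy e or from the copy e rho above. *)
    apply: (@set_size_le _ _ _ [:: id; (fun e : C -> C => e \o rho)]); try exact: finite_sheets.
    move=> e /fx[we [[ve xE]|[ve xE]]].
      by exists id; [left|exists e; [split|]].
    exists (fun e : C -> C => e \o rho); first by right; left.
    exists (e \o rho); last by rewrite comp_rhoK.
    by split=> //; rewrite xE rho_fix.
  have [-> _] := angle_fold_off wp px.
  apply: ler_wpMn2l => //; rewrite -[leqRHS]mul1n.
  apply: (@set_size_le _ _ _ [:: id]); try exact: finite_sheets.
  move=> e /fx[we [[ve xE]|[ve xE]]].
    by exists id; [left|exists e; [split|]].
  have := pt_inj vd ve vp (hull_w_rho wp) xE.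
  by move/(congr1 xc); rewrite xc_rho; lra.
have wp := hull_v_rho vp (ltW px).
have wd' := dih_w_rho wd.
rewrite fold_left ?(ltW px)// !cone_angle_pt//.
have [|_ aE] := angle_fold_off wp; first by rewrite xc_rho oppr_gt0.
rewrite rhoK in aE; rewrite aE.
have a0 := ltW (angle_w_gt0 wp).
apply: ler_wpMn2l => //; rewrite -[leqRHS]mul1n.
apply: (@set_size_le _ _ _ [:: (fun e : C -> C => e \o rho)]); try exact: finite_sheets.
move=> e [we /esym ep].
have : lift e (rho p) (pt v d p).
  by apply: (lift_pt _ _ _ _ ep) => //; right; rewrite comp_rhoK rhoK.
move=> [[ve xE]|[ve xE]].
  have := pt_inj vd ve vp (hull_rho vp) xE.
  by move/(congr1 xc); rewrite xc_rho; lra.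
exists (fun e : C -> C => e \o rho); first by left.
exists (e \o rho); last by rewrite comp_rhoK.
by split=> //; rewrite xE rhoK.
Qed.

(** * The degree of the fold *)

Lemma fold_cover deg : ramified_cover deg f -> translation_cover deg f.
Proof.
move=> rf; split=> //.
- apply: holomorphic_of_flat.
  + exact: fold_continuous.
  + exact: fold_flat.
  + exact: cone_angle_w_gt0.
  + exact: cone_angle_fold.
- apply: translation_of_flat; [exact: fold_continuous|exact: fold_flat].
Qed.

(** At most one lift exists, so the fold is a bijection; it is its own sheet. *)
Lemma fold_ramified1 : (forall d, dihedral v d -> ~ dihedral v (d \o rho)) ->
  ramified_cover 1 f.
Proof.
move=> H; split; [exact: fold_continuous|exact: fold_surj|exact: fold_finite_fiber|].
have finj : injective f.
  move=> x x' e; have [d [q [wd wq l]]] := lift_total x.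
  have : f x' = pt w d q by rewrite -e; exact: fE.
  move=> /(fold_fiber wd wq); case: l => -[vd ->] [[vd' ->]|[vd' ->]] //.
  - by case: (H _ vd).
  - by case: (H _ vd').
exists set0 => // y _; exists setT; split=> //; first exact: openT.
exists (fun=> setT); split=> [_|i j _ _ _||s].
- exact: openT.
- by rewrite !ord1.
- by rewrite preimage_setT; apply/seteqP; split=> // x _; exists ord0.
- split; last exact: fold_surj.
  split=> [x _|x x' _ _|W oW _].
  + exact: fold_continuous.
  + exact: finj.
  + exact: fold_open.
Qed.

Section DegreeTwo.
Context (Hwv : forall d, dihedral w d -> dihedral v d).

Let vrho d : dihedral v d -> dihedral v (d \o rho).
Proof. by move=> /dih_v_w/dih_w_rho/Hwv. Qed.

(** Both lifts always exist, so the fibres are the orbits of the involution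
    (d, p) |-> (d rho, rho p). *)
Lemma fold_twin d p x : dihedral v d -> hull v p ->
  f x = f (pt v d p) <-> x = pt v d p \/ x = pt v (d \o rho) (rho p).
Proof.
move=> vd vp; have wd := dih_v_w vd; have wd' := dih_w_rho wd; have vd' := vrho vd.
have [px|/ltW px] := leP 0 (xc p).
  have wp := hull_v_w vp px; rewrite fold_right//; split.
    by move=> /(fold_fiber wd wp)[[_ ->]|[_ ->]]; [left|right].
  by move=> [->|->]; apply: fE => //; [left|right].
have wp := hull_v_rho vp px; rewrite fold_left//; split.
  by move=> /(fold_fiber wd' wp)[[_ ->]|[_ ->]]; [right|left; rewrite comp_rhoK rhoK].
by move=> [->|->]; apply: fE => //; [right; rewrite comp_rhoK rhoK|left].
Qed.

(** If the involution moves an open set U0 off itself, then U0 and its image are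
    the two sheets over f U0: they are mapped injectively, and the fold is open. *)
Lemma evenly_covered_twin (U0 U1 : set (surface v)) :
  open U0 -> open U1 -> (forall x, U0 x -> U1 x -> False) ->
  (forall d p, dihedral v d -> hull v p -> U0 (pt v d p) -> U1 (pt v (d \o rho) (rho p))) ->
  (forall d p, dihedral v d -> hull v p -> U1 (pt v d p) -> U0 (pt v (d \o rho) (rho p))) ->
  open (f @` U0) /\ evenly_covered 2 f (f @` U0).
Proof.
move=> oU0 oU1 dis t01 t10; split; first exact: fold_open.
pose U (s : 'I_2) := if s == ord0 then U0 else U1.
have UE (P : 'I_2 -> Prop) : P ord0 -> P ord_max -> forall s, P s.
  move=> P0 P1 [[|[|//]] lts].
    by rewrite (_ : Ordinal _ = ord0)//; exact: val_inj.
  by rewrite (_ : Ordinal _ = ord_max)//; exact: val_inj.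
have twin_f d p : dihedral v d -> hull v p ->
    f (pt v (d \o rho) (rho p)) = f (pt v d p).
  by move=> vd vp; apply/fold_twin => //; right.
have fU : f @` U1 = f @` U0.
  apply/seteqP; split=> [_ [x + <-]|_ [x + <-]]; move: x; apply: surface_ind => d p vd vp.
    by move=> /(t10 _ _ vd vp) H; exists (pt v (d \o rho) (rho p)); rewrite ?twin_f.
  by move=> /(t01 _ _ vd vp) H; exists (pt v (d \o rho) (rho p)); rewrite ?twin_f.
have fU0 s : f @` U s = f @` U0 by move: s; apply: UE.
have inj s : {in U s &, injective f}.
  suff H (V0 V1 : set (surface v)) : (forall x, V0 x -> V1 x -> False) ->
    (forall d p, dihedral v d -> hull v p -> V0 (pt v d p) -> V1 (pt v (d \o rho) (rho p))) ->
    {in V0 &, injective f}.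
    move: s; apply: UE; first exact: (H U0 U1).
    by apply: (H U1 U0) => // x ? ?; exact: (dis x).
  move=> dV t01V x x' /set_mem + /set_mem Vx'.
  move: x; apply: surface_ind => d p vd vp Vp /esym/(fold_twin _ vd vp)[//|xE].
  by case: (dV x' Vx'); rewrite xE; exact: t01V.
exists U; split=> [s||| s].
- by move: s; apply: UE.
- apply/trivIsetP => i j _ _ ij; apply/seteqP; split=> // x []; move: i j ij.
  by apply: (UE); apply: (UE) => // _; rewrite /U/=; [|move=> ? ?]; [exact: dis|exact: (dis x)].
- apply/seteqP; split=> [x|x [s _]].
    move=> [x0]; move: x0; apply: surface_ind => d p vd vp U0p /esym.
    move=> /(fold_twin _ vd vp)[->|->]; first by exists ord0.
    by exists ord_max => //; exact: t01.
  move=> Ux; have : (f @` U s) (f x) by exists x.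
  by rewrite fU0.
- split; last exact: fU0.
  split; [|exact: inj|].
  + by move=> x _; exact: fold_continuous.
  + by move=> W oW _; exact: fold_open.
Qed.

Lemma dih_w_inj d : dihedral w d -> injective d.
Proof.
elim=> // {}d i _ IH x y /= /IH e.
have := congr1 (reflection w i) e.
by move/funeqP: (reflK_w i) => H; have := H x; have := H y => /= -> ->.
Qed.

Lemma comp_rho_neq d : dihedral w d -> d \o rho <> d.
Proof.
move=> wd /funeqP/(_ b)/= /(dih_w_inj wd) /(congr1 xc).
by rewrite xc_rho; have [_ [-> _] _ _] := coord_vertices; lra.
Qed.

Lemma interior_v z : 0 < yc z -> xc z + yc z < 1 -> yc z - xc z < 1 ->
  hull v z /\ forall i, ~ side v i z.
Proof.
move=> h1 h2 h3; split; first by apply/hull_vP; split; lra.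
by apply: ord3_ind => [/side_v0[]|/side_v1[]|/side_v2[]]; lra.
Qed.

(** An interior point of a copy has no other representative. *)
Lemma open_interior_copy d : dihedral v d ->
  open [set x | exists p, [/\ 0 < yc p, xc p + yc p < 1, yc p - xc p < 1 &
                 x = pt v d p]].
Proof.
move=> vd; apply/open_surfaceP => e p ve vp [p' [h1 h2 h3 xE]].
have [vp' np'] := interior_v h1 h2 h3.
have pp := pt_inj ve vd vp vp' xE; rewrite -pp in h1 h2 h3 xE np'.
have ed := pt_inj_interior ve vd vp np' xE; rewrite ed.
have c1 : \forall q \near p, 0 < yc q by exact: (@cvgr_gt R C (nbhs p) _ yc _ (@yc_cts p) _ h1).
have c2 : \forall q \near p, xc q + yc q < 1.
  apply: (@cvgr_lt R C (nbhs p) _ (fun q => xc q + yc q) _ _ _ h2).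
  by apply: cvgD; [exact: xc_cts|exact: yc_cts].
have c3 : \forall q \near p, yc q - xc q < 1.
  apply: (@cvgr_lt R C (nbhs p) _ (fun q => yc q - xc q) _ _ _ h3).
  by apply: cvgB; [exact: yc_cts|exact: xc_cts].
by apply: filterS3 c1 c2 c3 => q *; exists q.
Qed.

Lemma open_half (P : R -> Prop) : (forall p, P (xc p) -> \forall q \near p, P (xc q)) ->
  open [set x | exists d p, [/\ dihedral v d, hull v p, P (xc p) & x = pt v d p]].
Proof.
move=> oP; apply/open_surfaceP => e p ve vp [d [p' [vd vp' Pp xE]]].
rewrite -(pt_inj ve vd vp vp' xE) in Pp.
by apply: filterS (oP _ Pp) => q Pq vq; exists e, q.
Qed.

(** The branch points lie below the ends of the axis: the midpoint of the base
    and the apex.  Off the axis the open halves are exchanged by the involution,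
    and at an inner point of the axis the interiors of d . v and (d rho) . v
    are. *)
Lemma fold_ramified2 : ramified_cover 2 f.
Proof.
split; [exact: fold_continuous|exact: fold_surj|exact: fold_finite_fiber|].
exists ([set pt w d 0 | d in dihedral w] `|` [set pt w d apex | d in dihedral w]).
  by rewrite finite_setU; split; exact: finite_image.
apply: surface_ind => d q wd wq nB.
have vd := Hwv wd; have vq := hull_w_v wq; have vd' := vrho vd.
have [x1 y1 xy1] := iffLR (hull_wP q) wq.
have fq : f (pt v d q) = pt w d q by apply: fE => //; left.
suff [U0 [U1 [oU0 oU1 dis [t01 t10 U0q]]]] : exists U0 U1 : set (surface v),
    [/\ open U0, open U1, forall x, U0 x -> U1 x -> False &
    [/\ forall d p, dihedral v d -> hull v p -> U0 (pt v d p) -> U1 (pt v (d \o rho) (rho p)),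
        forall d p, dihedral v d -> hull v p -> U1 (pt v d p) -> U0 (pt v (d \o rho) (rho p)) &
        U0 (pt v d q)]].
  have [oV ecV] := evenly_covered_twin oU0 oU1 dis t01 t10.
  by exists (f @` U0); split=> //; exists (pt v d q).
move: x1; rewrite le_eqVlt => /predU1P[/esym x0|x1].
(* The point q is on the axis: take the interiors of two copies of v. *)
- pose Ui e := [set x | exists p, [/\ 0 < yc p, xc p + yc p < 1, yc p - xc p < 1 &
                 x = pt v e p]].
  exists (Ui d), (Ui (d \o rho)); split; [exact: open_interior_copy|exact: open_interior_copy| |].
    move=> x [p [h1 h2 h3 ->]] [p' [h1' h2' h3' xE]].
    have [vp np] := interior_v h1 h2 h3; have [vp' np'] := interior_v h1' h2' h3'.
    have pp := pt_inj vd vd' vp vp' xE; rewrite -pp in xE.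
    exact: (comp_rho_neq wd (esym (pt_inj_interior vd vd' vp np xE))).
  split.
  + move=> e p ve vp [p' [h1 h2 h3 xE]]; have [vp' np'] := interior_v h1 h2 h3.
    have pp := pt_inj ve vd vp vp' xE; rewrite -pp in xE h1 h2 h3 np'.
    rewrite (pt_inj_interior ve vd vp np' xE).
    by exists (rho p); rewrite xc_rho yc_rho; split=> //; lra.
  + move=> e p ve vp [p' [h1 h2 h3 xE]]; have [vp' np'] := interior_v h1 h2 h3.
    have pp := pt_inj ve vd' vp vp' xE; rewrite -pp in xE h1 h2 h3 np'.
    rewrite (pt_inj_interior ve vd' vp np' xE) comp_rhoK.
    by exists (rho p); rewrite xc_rho yc_rho; split=> //; lra.
  + have [[x00 y00] _ _ [xa ya]] := coord_vertices.
    exists q; rewrite x0; split=> //.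
    * rewrite lt_neqAle y1 andbT; apply/eqP => y0; apply: nB; left; exists d => //.
      by congr pt; apply: coord_inj; rewrite ?x00 ?y00.
    * rewrite add0r lt_neqAle; apply/andP; split; last by lra.
      apply/eqP => y0; apply: nB; right; exists d => //.
      by congr pt; apply: coord_inj; rewrite ?xa ?ya.
    * rewrite subr0 lt_neqAle; apply/andP; split; last by lra.
      apply/eqP => y0; apply: nB; right; exists d => //.
      by congr pt; apply: coord_inj; rewrite ?xa ?ya.
(* The point q is off the axis: take the two open halves of all copies. *)
- exists [set x | exists d p, [/\ dihedral v d, hull v p, 0 < xc p & x = pt v d p]].
  exists [set x | exists d p, [/\ dihedral v d, hull v p, xc p < 0 & x = pt v d p]].
  split.
  + apply: (@open_half (fun r => 0 < r)) => p px.
    exact: (@cvgr_gt R C (nbhs p) _ xc _ (@xc_cts p) _ px).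
  + apply: (@open_half (fun r => r < 0)) => p px.
    exact: (@cvgr_lt R C (nbhs p) _ xc _ (@xc_cts p) _ px).
  + move=> x [e [p [ve vp p0 ->]]] [e' [p' [ve' vp' p0' xE]]].
    by move: p0'; rewrite -(pt_inj ve ve' vp vp' xE); lra.
  + split.
    * move=> e p ve vp [e' [p' [ve' vp' p0 xE]]].
      rewrite -(pt_inj ve ve' vp vp' xE) in p0.
      exists (e \o rho), (rho p); split=> //; [exact: vrho|exact: hull_rho|].
      by rewrite xc_rho; lra.
    * move=> e p ve vp [e' [p' [ve' vp' p0 xE]]].
      rewrite -(pt_inj ve ve' vp vp' xE) in p0.
      exists (e \o rho), (rho p); split=> //; [exact: vrho|exact: hull_rho|].
      by rewrite xc_rho; lra.
    * by exists d, q.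
Qed.

End DegreeTwo.

End FoldMap.

(** Rotations by an N-th root of unity, possibly composed with the reflection in
    the base. *)
Definition dihedral_form (N : nat) d : Prop := exists2 e : C, e ^+ N = 1 &
  d = (fun z => e * z) \/ d = (fun z => e * (axis * z^*)).

Lemma unit_rootJ (N : nat) (g : C) : g ^+ N = 1 -> g^* ^+ N = 1.
Proof. by move=> gN; rewrite -rmorphXn/= gN rmorph1. Qed.

Lemma dihedral_form_comp (N : nat) d (g : C) : dihedral_form N d -> g ^+ N = 1 ->
  dihedral_form N (d \o (fun z => g * (axis * z^*))).
Proof.
move=> [e eN [->|->]] gN.
  exists (e * g); first by rewrite exprMn eN gN mulr1.
  by right; apply/funext => z /=; rewrite mulrA.
exists (e * g^*); first by rewrite exprMn eN unit_rootJ// mulr1.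
left; apply/funext => z /=; rewrite (rmorphM _ g)/= (rmorphM _ axis)/= conjCK axisJ.
by rewrite -mulrA; congr (_ * _); rewrite mulrCA; congr (_ * _); rewrite mulrA divff ?mul1r ?axis0.
Qed.

Lemma dihedral_form1 N : dihedral_form N id.
Proof. by exists 1; [rewrite expr1n|left; apply/funext => z; rewrite mul1r]. Qed.

Lemma conj_tau : rho \o tau \o rho = (fun z => omega^-1 * (axis * z^*)).
Proof.
by apply/funext => z; rewrite /= tau_rho /rho rmorphN/= (rmorphM _ omega)/= omegaJ mulrN opprK mulrCA.
Qed.

Lemma tauE : tau = (fun z => omega * (axis * z^*)).
Proof. by apply/funext => z; rewrite /tau mulrA. Qed.

Lemma sigmaE : sigma = (fun z => 1 * (axis * z^*)).
Proof. by apply/funext => z; rewrite mul1r. Qed.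

Lemma rhoE : rho = (fun z => -1 * (axis * z^*)).
Proof. by apply/funext => z; rewrite mulN1r. Qed.

Lemma dihedral_v_form N d : omega ^+ N = 1 -> dihedral v d -> dihedral_form N d.
Proof.
move=> oN; elim=> [|{}d i _ IH]; first exact: dihedral_form1.
move: i; apply: ord3_ind; rewrite ?refl_v0 ?refl_v1 ?refl_v2 ?conj_tau ?tauE ?sigmaE;
  apply: dihedral_form_comp => //.
- by rewrite expr1n.
- by rewrite exprVn oN invr1.
Qed.

Lemma dihedral_w_form N d : omega ^+ N = 1 -> ~~ odd N -> dihedral w d -> dihedral_form N d.
Proof.
move=> oN eN; elim=> [|{}d i _ IH]; first exact: dihedral_form1.
move: i; apply: ord3_ind_bc; rewrite ?refl_w0 ?refl_wb ?refl_wc ?rhoE ?tauE ?sigmaE;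
  apply: dihedral_form_comp => //.
- by rewrite -signr_odd (negPf eN).
- by rewrite expr1n.
Qed.

Lemma dihedral_w_finite N : (0 < N)%N -> omega ^+ N = 1 -> ~~ odd N -> finite_set (dihedral w).
Proof.
move=> N0 oN eN; pose F := [set x : C | x ^+ N = 1].
have fF : finite_set F by exact: finite_unity_roots.
apply: (@sub_finite_set _ _ ([set (fun z : C => e * z) | e in F] `|`
   [set (fun z : C => e * (axis * z^*)) | e in F])).
  move=> d /(dihedral_w_form oN eN)[e eN1 [->|->]]; [left|right]; by exists e.
by rewrite finite_setU; split; exact: finite_image.
Qed.

(** If d and d rho were both in the group, then d b = e b and d (rho b) = e' b
    with e ^+ n = e' ^+ n = 1.  As rho b = - b this forces e' = - e, which is
    impossible for odd n. *)
Lemma dihedral_v_odd n : odd n -> omega ^+ n = 1 ->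
  forall d, dihedral v d -> ~ dihedral v (d \o rho).
Proof.
move=> on on1 d vd vd'.
have [e en dE] := dihedral_v_form on1 vd.
have [e' en' dE'] := dihedral_v_form on1 vd'.
have axb : axis * b^* = b by rewrite /axis mulfVK.
have rb : rho b = - b by rewrite /rho axb.
have db : d (- b) = - (e * b).
  by case: dE => ->; rewrite ?mulrN// rmorphN/= !mulrN axb.
have db' : d (rho b) = e' * b.
  by case: dE' => /funeqP/(_ b)/= ->; rewrite ?axb.
have ee : e' = - e.
  by apply: (mulIf b0); rewrite -db' rb db mulNr.
have : (1 : C) = -1 by rewrite -{1}en' ee exprNn -signr_odd on en expr1 mulr1.
by move/eqP; rewrite gt_eqF// gtrN.
Qed.

Lemma dihedral_mul u d d' : dihedral u d -> dihedral u d' -> dihedral u (d \o d').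
Proof. by move=> ud; elim=> // {}d' i _ IH; exact: (dihedralM i IH). Qed.

(** The rotation omega is tau sigma, so its n-th power, the rotation by pi, is in
    the group of v; composed with sigma it gives rho. *)
Lemma dihedral_v_full n : omega ^+ n = -1 -> forall d, dihedral w d -> dihedral v d.
Proof.
move=> on.
have vom k : dihedral v (fun z => omega ^+ k * z).
  elim: k => [|k IH].
    rewrite (_ : (fun _ => _) = id); first exact: dihedral1.
    by apply/funext => z; rewrite mul1r.
  have := dih_v_sigma (dih_v_tau IH); congr dihedral.
  apply/funext => z; rewrite /=.
  have -> : sigma z = rho (- z) by rewrite /rho rmorphN/= mulrN opprK.
  by rewrite tau_rho !mulrN opprK exprSr mulrA.
have vrho : dihedral v rho.
  have := dih_v_sigma (vom n); congr dihedral.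
  by apply/funext => z; rewrite /= on mulN1r.
move=> d /dih_w_v[//|vd]; rewrite -(comp_rhoK d); exact: dihedral_mul.
Qed.

Context (aw0 : vertex_angle w 0 = pi / 2)
  (av0 : vertex_angle v 0 = 2 * vertex_angle w kc)
  (av1 : vertex_angle v 1 = vertex_angle w kb)
  (av2 : vertex_angle v (-1) = vertex_angle w kb)
  (awb_gt0 : 0 < vertex_angle w kb) (awc_gt0 : 0 < vertex_angle w kc).

Lemma fold_cover_degree1 n : odd n -> omega ^+ n = 1 ->
  exists f : surface v -> surface w, translation_cover 1 f.
Proof.
move=> on on1; have [f fE] := fold_exists; exists f.
have n20 : (0 < 2 * n)%N by case: n on {on1}.
apply: fold_cover => //.
  apply: (@dihedral_w_finite (2 * n)) => //; last by rewrite oddM.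
  by rewrite mulnC exprM on1 expr1n.
by apply: fold_ramified1 => //; exact: dihedral_v_odd on1.
Qed.

Lemma fold_cover_degree2 n : (0 < n)%N -> omega ^+ n = -1 ->
  exists f : surface v -> surface w, translation_cover 2 f.
Proof.
move=> n0 on1; have [f fE] := fold_exists; exists f.
have fw : finite_set (dihedral w).
  apply: (@dihedral_w_finite (2 * n)); [by rewrite muln_gt0| |by rewrite oddM].
  by rewrite mulnC exprM on1 expr2 mulrNN mulr1.
apply: fold_cover => //.
by apply: fold_ramified2 => //; exact: dihedral_v_full on1.
Qed.

End Fold.

(** * Right and isosceles triangles of given angles *)

Lemma cos_sin_natpi (R : realType) n :
  cos (pi *+ n : R) = (-1) ^+ n /\ sin (pi *+ n : R) = 0.
Proof.
elim: n => [|n [IHc IHs]]; first by rewrite mulr0n cos0 sin0 expr0.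
rewrite (mulrS (@pi R)) cosD (sinD pi (pi *+ n)) cospi sinpi IHc IHs exprS.
by rewrite !(mul0r, mulr0) subr0 addr0.
Qed.

Section Angles.
Context {R : realType}.
Local Notation C := (plane R).

Definition angle_between (x y : C) : R := acos (complex.Re (x * y^* / `|x * y|)).

Lemma angle_between_sym x y : angle_between x y = angle_between y x.
Proof.
rewrite /angle_between; congr acos.
have -> : y * x^* / `|y * x| = (x * y^* / `|x * y|)^*.
  rewrite rmorphM/= fmorphV/= conj_normC (rmorphM _ x)/= conjCK.
  by rewrite [x * y]mulrC [x^* * y]mulrC.
by case: (_ / _).
Qed.

(** The sign e allows for both orientations of the pair of sides. *)
Lemma angle_betweenE (x y : C) (r e phi : R) : 0 < r -> e ^+ 2 = 1 ->
  0 <= phi <= pi -> x * y^* = r%:C%C * (cos phi +i* (e * sin phi))%C ->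
  angle_between x y = phi.
Proof.
move=> r0 e1 phi_pi xy; rewrite /angle_between.
have n1 : `|(cos phi +i* (e * sin phi))%C| = 1 :> C.
  by rewrite normc_def/= exprMn e1 mul1r cos2Dsin2 sqrtr1.
have -> : `|x * y| = r%:C%C.
  rewrite normrM -(norm_conjC y) -normrM xy normrM n1 mulr1.
  by rewrite normc_def/= expr0n/= addr0 sqrtr_sqr gtr0_norm.
have rC0 : r%:C%C != 0 :> C by rewrite eq_complex/= negb_and gt_eqF.
by rewrite xy mulrAC divff// mul1r/= cosK// in_itv.
Qed.

Lemma mul_conj_real (b : C) : b != 0 -> exists2 r : R, 0 < r & b * b^* = r%:C%C.
Proof.
rewrite -mul_conjC_gt0; case: (b * b^*) => x y; rewrite ltcE/= => /andP[/eqP -> x0].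
by exists x.
Qed.

Lemma acute_ranges (x : R) : 0 < x -> x < pi / 2 ->
  [/\ 0 <= x <= pi, 0 <= pi / 2 - x <= pi, 0 <= pi - 2 * x <= pi &
      0 <= pi / 2 :> R /\ pi / 2 <= pi :> R].
Proof.
have := pi_gt0 R; move: (@pi R) => y y0 x0 x1.
by split; [apply/andP; split|apply/andP; split|apply/andP; split|split]; lra.
Qed.

Section Shape.
Context (b : C) (theta e : R) (w : 'I_3 -> C) (kb kc : 'I_3).
Context (b0 : b != 0) (e1 : e ^+ 2 = 1) (theta_gt0 : 0 < theta) (theta_lt : theta < pi / 2).
Let lam : R := e * (sin theta / cos theta).
Let apex : C := b * ('i%C * lam%:C%C).
Context (kbc : kb = 1 /\ kc = -1 \/ kb = -1 /\ kc = 1)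
  (w0 : w 0 = 0) (wb : w kb = b) (wc : w kc = apex).
Local Notation v := (isosceles b lam).

Let cos_gt0 : 0 < cos theta.
Proof. by have pi0 := pi_gt0 R; apply: cos_gt0_pihalf; rewrite theta_lt andbT; apply: lt_trans theta_gt0; rewrite oppr_lt0 divr_gt0. Qed.

Let sin_gt0 : 0 < sin theta.
Proof. by have pi0 := pi_gt0 R; apply: sin_gt0_pi; rewrite theta_gt0; apply: lt_trans theta_lt _; lra. Qed.

Let e0 : e != 0.
Proof. by apply: contra_eq_neq e1 => ->; rewrite expr0n/= eq_sym oner_eq0. Qed.

Lemma lam_neq0 : lam != 0.
Proof. by rewrite mulf_neq0// mulf_neq0 ?invr_eq0 ?gt_eqF. Qed.

Let apexJ : apex^* = - (b^* * ('i%C * lam%:C%C)).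
Proof. by rewrite /apex rmorphM/= [(_ * _)^*]rmorphM/= conj_real conj_i mulNr mulrN. Qed.

Lemma vertex_angles_w : [/\ vertex_angle w 0 = pi / 2, vertex_angle w kb = theta &
  vertex_angle w kc = pi / 2 - theta].
Proof.
have [r r0 bbJ] := mul_conj_real b0.
have [k1 k2 k3 k4] := ord3E.
have a0 : vertex_angle w 0 = angle_between b apex.
  rewrite /vertex_angle -[LHS]/(angle_between (w (0 + 1) - w 0) (w (0 - 1) - w 0)).
  rewrite k1 add0r w0 !subr0; move: wb wc; case: kbc => -[-> ->] -> -> //.
  exact: angle_between_sym.
have ab : vertex_angle w kb = angle_between (- b) (apex - b).
  rewrite /vertex_angle -[LHS]/(angle_between (w (kb + 1) - w kb) (w (kb - 1) - w kb)).
  move: wb wc; case: kbc => -[-> ->] wb' wc';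
    rewrite ?subrr ?k2 ?k3 ?k4 w0 wb' wc' sub0r//.
  exact: angle_between_sym.
have ac : vertex_angle w kc = angle_between (- apex) (b - apex).
  rewrite /vertex_angle -[LHS]/(angle_between (w (kc + 1) - w kc) (w (kc - 1) - w kc)).
  move: wb wc; case: kbc => -[-> ->] wb' wc';
    rewrite ?subrr ?k2 ?k3 ?k4 w0 wb' wc' sub0r//.
  exact: angle_between_sym.
have [range1 range2 range3 [range4 range5]] := acute_ranges theta_gt0 theta_lt.
rewrite a0 ab ac; split.
- apply: (@angle_betweenE _ _ (r * (sin theta / cos theta)) (- e)).
  + by rewrite !mulr_gt0 ?invr_gt0.
  + by rewrite sqrrN.
  + by rewrite range4.
  + rewrite cos_pihalf sin_pihalf mulr1 apexJ mulrN (mulrA b) bbJ /lam.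
    apply/eqP; rewrite eq_complex/=; apply/andP; split; apply/eqP; ring.
- apply: (@angle_betweenE _ _ (r / cos theta) e) => //.
  + by rewrite divr_gt0.
  + rewrite rmorphB/= apexJ (_ : _ * _ = (b * b^*) * (1 + 'i%C * lam%:C%C)); last by ring.
    rewrite bbJ /lam.
    apply/eqP; rewrite eq_complex/=; apply/andP; split; apply/eqP; field; by rewrite gt_eqF.
- apply: (@angle_betweenE _ _ (r * sin theta / cos theta / cos theta) (- e)) => //.
  + by rewrite !mulr_gt0 ?invr_gt0.
  + by rewrite sqrrN.
  + rewrite rmorphB/= apexJ (_ : _ * _ = (b * b^*) * ((- ('i%C * lam%:C%C)) * (1 + 'i%C * lam%:C%C))); last first.
      by rewrite /apex; ring.
    rewrite bbJ /lam cosB sinB cos_pihalf sin_pihalf.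
    apply/eqP; rewrite eq_complex/=; apply/andP; split; apply/eqP.
      rewrite (_ : _ - _ = r * e ^+ 2 * (sin theta / cos theta) ^+ 2); last by ring.
      by rewrite e1; field; rewrite gt_eqF.
    by field; rewrite gt_eqF.
Qed.

Lemma vertex_angles_v : [/\ vertex_angle v 0 = pi - 2 * theta, vertex_angle v 1 = theta &
  vertex_angle v (-1) = theta].
Proof.
have [r r0 bbJ] := mul_conj_real b0.
have [k1 k2 k3 k4] := ord3E.
have [range1 range2 range3 _] := acute_ranges theta_gt0 theta_lt.
have [v0 v1 v2] := vE b lam.
have a0 : vertex_angle v 0 = angle_between (b - apex) (- b - apex).
  by rewrite /vertex_angle k1 add0r v0 v1 v2.
have a1 : vertex_angle v 1 = angle_between (- b - b) (apex - b).
  by rewrite /vertex_angle k2 subrr v0 v1 v2.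
have a2 : vertex_angle v (-1) = angle_between (apex + b) (b + b).
  by rewrite /vertex_angle k3 k4 v0 v1 v2 !opprK.
rewrite a0 a1 a2; split.
- apply: (@angle_betweenE _ _ (r / cos theta / cos theta) e) => //.
  + by rewrite !mulr_gt0 ?invr_gt0.
  + rewrite rmorphB rmorphN/= apexJ (_ : _ * _ = - (b * b^*) * (1 - 'i%C * lam%:C%C) ^+ 2); last first.
      by rewrite /apex; ring.
    have lam2 : lam ^+ 2 = (1 - cos theta ^+ 2) / cos theta ^+ 2.
      by rewrite /lam exprMn e1 mul1r expr_div_n sin2cos2.
    rewrite bbJ cosB sinB cospi sinpi mulr_natl cos_mulr2n sin_mulr2n.
    apply/eqP; rewrite eq_complex/=; apply/andP; split; apply/eqP.
      transitivity (- r * (1 - lam ^+ 2)); first by ring.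
      by rewrite lam2; field; rewrite gt_eqF.
    transitivity (2 * r * lam); first by ring.
    by rewrite /lam; field; rewrite gt_eqF.
- apply: (@angle_betweenE _ _ (2 * r / cos theta) e) => //.
  + by rewrite divr_gt0// mulr_gt0.
  + rewrite rmorphB/= apexJ (_ : _ * _ = 2 * (b * b^*) * (1 + 'i%C * lam%:C%C)); last by ring.
    rewrite bbJ /lam.
    apply/eqP; rewrite eq_complex/=; apply/andP; split; apply/eqP; field; by rewrite gt_eqF.
- apply: (@angle_betweenE _ _ (2 * r / cos theta) e) => //.
  + by rewrite divr_gt0// mulr_gt0.
  + rewrite rmorphD/= (_ : _ * _ = 2 * (b * b^*) * (1 + 'i%C * lam%:C%C)); last by rewrite /apex; ring.
    rewrite bbJ /lam.
    apply/eqP; rewrite eq_complex/=; apply/andP; split; apply/eqP; field; by rewrite gt_eqF.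
Qed.

Lemma nondegenerate_v : nondegenerate_triangle v.
Proof.
have [r r0 bbJ] := mul_conj_real b0.
rewrite /nondegenerate_triangle; have [-> -> ->] := vE b lam.
rewrite rmorphB/= apexJ (_ : _ * _ = - (b * b^*) * (1 + 'i%C * lam%:C%C) ^+ 2); last first.
  by rewrite /apex; ring.
rewrite bbJ expr2 (_ : complex.Im _ = - (2 * r * lam)); last by rewrite /=; ring.
by rewrite oppr_eq0 mulf_neq0 ?lam_neq0// mulf_neq0 ?pnatr_eq0// gt_eqF.
Qed.

Lemma nondegenerate_w : nondegenerate_triangle w.
Proof.
have [r r0 bbJ] := mul_conj_real b0.
rewrite /nondegenerate_triangle w0 !subr0.
have rl : r * lam != 0 by rewrite mulf_neq0 ?lam_neq0 ?gt_eqF.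
move: wb wc; case: kbc => -[-> ->] -> ->.
  rewrite (_ : _ * _ = (b * b^*) * ('i%C * lam%:C%C)); last by rewrite /apex; ring.
  by rewrite bbJ (_ : complex.Im _ = r * lam)//=; ring.
rewrite apexJ (_ : _ * _ = - (b * b^*) * ('i%C * lam%:C%C)); last by ring.
by rewrite bbJ (_ : complex.Im _ = - (r * lam)) ?oppr_eq0//=; ring.
Qed.

(** De Moivre's formula, for the angle x or - x according to the sign e. *)
Lemma de_moivre (x : R) n :
  (cos x +i* (- e * sin x))%C ^+ n = (cos (x *+ n) +i* (- e * sin (x *+ n)))%C :> C.
Proof.
elim: n => [|n IH].
  by rewrite expr0 mulr0n cos0 sin0 mulr0.
rewrite exprS IH mulrS cosD sinD; apply/eqP; rewrite eq_complex/=; apply/andP; split; apply/eqP.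
  rewrite (_ : _ * sin _ * _ = e ^+ 2 * (sin x * sin (x *+ n))); last by ring.
  by rewrite e1 mul1r.
by ring.
Qed.

(** The number 1 - i lam is a real multiple of cos theta - i e sin theta, and
    omega is its quotient by its conjugate. *)
Lemma omega_pow n :
  omega lam ^+ n = (cos (theta *+ (2 * n)) +i* (- e * sin (theta *+ (2 * n))))%C.
Proof.
rewrite -de_moivre exprM; congr (_ ^+ _).
have [_ h] := ilam_neq0 lam; rewrite /omega; apply: (canLR (mulfK h)).
rewrite expr2 /lam; apply/eqP; rewrite eq_complex/=; apply/andP; split; apply/eqP.
  transitivity (cos theta ^+ 2 + e ^+ 2 * sin theta ^+ 2); last by field; rewrite gt_eqF.
  by rewrite e1 mul1r cos2Dsin2; ring.
transitivity (- (e * (sin theta / cos theta)) * (cos theta ^+ 2 + e ^+ 2 * sin theta ^+ 2)).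
  by rewrite e1 mul1r cos2Dsin2; ring.
by field; rewrite gt_eqF.
Qed.

Context (ai aj : nat) (ai_gt0 : (0 < ai)%N) (aj_gt0 : (0 < aj)%N)
  (aij : coprime ai aj) (thetaE : theta = ai%:R * pi / (2 * (ai + aj))%:R).

Let ij0 : (ai + aj)%:R != 0 :> R.
Proof. by rewrite pnatr_eq0 -lt0n addn_gt0 ai_gt0. Qed.

Let omega_sign : omega lam ^+ (ai + aj) = (-1) ^+ ai.
Proof.
rewrite omega_pow (_ : theta *+ (2 * (ai + aj)) = pi *+ ai).
  have [-> ->] := cos_sin_natpi R ai; rewrite mulr0 -signr_odd -[RHS]signr_odd.
  by case: (odd ai); rewrite ?expr0 ?expr1//; apply/eqP; rewrite eq_complex/= ?oppr0 !eqxx.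
rewrite thetaE -[LHS]mulr_natr -[RHS]mulr_natl natrM; field.
by rewrite -natrD; exact: ij0.
Qed.

Let angle_hyps : [/\ vertex_angle w 0 = pi / 2,
  vertex_angle v 0 = 2 * vertex_angle w kc,
  vertex_angle v 1 = vertex_angle w kb &
  [/\ vertex_angle v (-1) = vertex_angle w kb,
  0 < vertex_angle w kb & 0 < vertex_angle w kc]].
Proof.
have [-> -> ->] := vertex_angles_w; have [-> -> ->] := vertex_angles_v.
split=> //; first by field.
by split=> //; rewrite subr_gt0.
Qed.

Lemma isosceles_cover_odd : odd ai ->
  exists u : 'I_3 -> C, is_triangle (2 * aj) ai ai u /\
    exists f : surface u -> surface w, translation_cover 2 f.
Proof.
move=> oi; exists v; split.
  have [a0 a1 a2] := vertex_angles_v.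
  have QE : (2 * aj + ai + ai)%:R = 2 * (ai + aj)%:R :> R.
    by rewrite -natrM; congr _%:R; lia.
  split; last 1 first.
  - rewrite a0 a1 a2 QE thetaE natrM (natrM _ 2 aj); split; field;
      by rewrite -?natrD ij0.
  - by rewrite muln_gt0 aj_gt0 ai_gt0.
  - by apply/eqP; rewrite gcdnn -/(coprime _ _) coprimeMl coprime2n oi coprime_sym.
  - exact: nondegenerate_v.
have [h1 h2 h3 [h4 h5 h6]] := angle_hyps.
apply: (fold_cover_degree2 b0 lam_neq0 kbc w0 wb wc h1 h2 h3 h4 h5 h6 (n := ai + aj)).
  by rewrite addn_gt0 ai_gt0.
by rewrite omega_sign -signr_odd oi expr1.
Qed.

Lemma isosceles_cover_even : ~~ odd ai ->
  exists u : 'I_3 -> C, is_triangle aj ai./2 ai./2 u /\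
    exists f : surface u -> surface w, translation_cover 1 f.
Proof.
move=> ei; exists v.
have aiE : ai = (2 * ai./2)%N by lia.
split.
  have [a0 a1 a2] := vertex_angles_v.
  have QE : (aj + ai./2 + ai./2)%:R = (ai + aj)%:R :> R.
    by congr _%:R; lia.
  have hE : ai%:R = 2 * ai./2%:R :> R by rewrite -natrM -aiE.
  split; last 1 first.
  - rewrite a0 a1 a2 QE thetaE natrM hE.
    have ajE : aj%:R = (ai + aj)%:R - 2 * ai./2%:R :> R by rewrite -hE natrD; ring.
    move: ajE ij0; move: ((ai + aj)%:R : R) => m -> m0.
    by split; field.
  - by rewrite aj_gt0 andbb; lia.
  - apply/eqP; rewrite gcdnn -/(coprime _ _).
    by rewrite coprime_sym; have := aij; rewrite {1}aiE coprimeMl => /andP[].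
  - exact: nondegenerate_v.
have [h1 h2 h3 [h4 h5 h6]] := angle_hyps.
apply: (fold_cover_degree1 b0 lam_neq0 kbc w0 wb wc h1 h2 h3 h4 h5 h6 (n := ai + aj)).
  have oj : odd aj.
    by have := aij; rewrite {1}aiE coprimeMl coprime2n => /andP[].
  by rewrite oddD oj (negPf ei).
by rewrite omega_sign -signr_odd (negPf ei) expr0.
Qed.

End Shape.
End Angles.

Theorem lemma3 (R : realType) (a : 'I_2 -> nat)
    (a_gt0 : forall i, (0 < a i)%N)
    (a_coprime : coprime (a ord0) (a ord_max))
    (a_neq1 : ~ (a ord0 = 1%N /\ a ord_max = 1%N)) :
  exists w : 'I_3 -> plane R,
    is_triangle (a ord0 + a ord_max)%N (a ord0) (a ord_max) w /\
    forall i j : 'I_2, i != j ->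
      (odd (a i) ->
         exists v : 'I_3 -> plane R,
           is_triangle (2 * a j)%N (a i) (a i) v /\
           exists f : surface v -> surface w, translation_cover 2 f) /\
      (~~ odd (a i) ->
         exists v : 'I_3 -> plane R,
           is_triangle (a j) (a i)./2 (a i)./2 v /\
           exists f : surface v -> surface w, translation_cover 1 f).
Proof.
pose n := (a ord0 + a ord_max)%N.
have p0 := a_gt0 ord0; have p1 := a_gt0 ord_max.
have n0 : n%:R != 0 :> R by rewrite pnatr_eq0 -lt0n addn_gt0 p0.
have nR : n%:R = (a ord0)%:R + (a ord_max)%:R :> R by rewrite natrD.
pose th (i : 'I_2) : R := (a i)%:R * pi / (2 * n)%:R.
have th_gt0 i : 0 < th i.
  by rewrite /th divr_gt0 ?mulr_gt0 ?pi_gt0 ?ltr0n ?a_gt0// muln_gt0/= addn_gt0 p0.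
have thD : th ord_max = pi / 2 - th ord0.
  rewrite /th natrM; move: n0 nR; move: (n%:R : R) => m m0 mE.
  rewrite (_ : (a ord_max)%:R = m - (a ord0)%:R); last by rewrite mE; ring.
  by field.
have th_lt i : th i < pi / 2.
  suff H (x y : 'I_2) : th x = pi / 2 - th y -> th x < pi / 2.
    move: i => [[|[|//]]] lti.
      rewrite (_ : Ordinal _ = ord0); last exact: val_inj.
      by apply: (H _ ord_max); rewrite thD opprB addrC subrK.
    rewrite (_ : Ordinal _ = ord_max); last exact: val_inj.
    exact: H thD.
  by move=> ->; rewrite gtrBl.
(* The hypotenuse has length 1 and the legs lie on the coordinate axes. *)
pose w (k : 'I_3) : plane R :=
  if k == 0 then 0 else if k == 1 then (cos (th ord0))%:C%C
  else 'i%C * (sin (th ord0))%:C%C.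
have cos0 : cos (th ord0) != 0.
  by rewrite gt_eqF// cos_gt0_pihalf// th_lt andbT (lt_trans _ (th_gt0 _))// oppr_lt0 divr_gt0// pi_gt0.
have sin0 : sin (th ord0) != 0.
  by rewrite gt_eqF// sin_gt0_pihalf// th_lt th_gt0.
have cos1 : cos (th ord_max) = sin (th ord0).
  by rewrite thD cosB cos_pihalf sin_pihalf mul0r mul1r add0r.
have sin1 : sin (th ord_max) = cos (th ord0).
  by rewrite thD sinB cos_pihalf sin_pihalf mul0r mul1r subr0.
have b0 : w 1 != 0 by rewrite /w/= eq_complex/= negb_and cos0.
have b1 : w (-1) != 0.
  rewrite /w/= eq_complex/= negb_and; apply/orP; right.
  by rewrite !(mul0r, mulr0, mul1r, addr0, add0r).
have e0 : (1 : R) ^+ 2 = 1 by rewrite expr1n.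
have e1 : (-1 : R) ^+ 2 = 1 by rewrite sqrrN expr1n.
have k0 : (1 : 'I_3) = 1 /\ (-1 : 'I_3) = -1 \/ (1 : 'I_3) = -1 /\ (-1 : 'I_3) = 1 by left.
have k1 : (-1 : 'I_3) = 1 /\ (1 : 'I_3) = -1 \/ (-1 : 'I_3) = -1 /\ (1 : 'I_3) = 1 by right.
(* For i = 0 the base is along the first leg, with half length w 1; the apex is
   w (-1). *)
have a0 : w (-1) = w 1 * ('i%C * (1 * (sin (th ord0) / cos (th ord0)))%:C%C).
  rewrite /w/=; apply/eqP; rewrite eq_complex/=; apply/andP; split; apply/eqP; by field.
(* For i = 1 the legs exchange their roles, which reverses the orientation. *)
have a1 : w 1 = w (-1) * ('i%C * (-1 * (sin (th ord_max) / cos (th ord_max)))%:C%C).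
  rewrite cos1 sin1 /w/=; apply/eqP; rewrite eq_complex/=; apply/andP; split; apply/eqP; by field.
have w0 : w 0 = 0 by [].
have th1 : th ord_max = (a ord_max)%:R * pi / (2 * (a ord_max + a ord0))%:R.
  by rewrite /th /n addnC.
have coprime1 : coprime (a ord_max) (a ord0) by rewrite coprime_sym.
exists w; split.
  have [v0 v1 v2] := vertex_angles_w b0 e0 (th_gt0 _) (th_lt _) k0 w0 erefl a0.
  have QE : (a ord0 + a ord_max + a ord0 + a ord_max)%:R = 2 * n%:R :> R.
    by rewrite -natrM; congr _%:R; rewrite /n; lia.
  split; last 1 first.
  - rewrite v0 v1 v2 -thD QE /th natrM; split=> //.
    by rewrite -/n; field.
  - by rewrite addn_gt0 p0 p1.
  - by apply/eqP; rewrite (eqP a_coprime) gcdn1.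
  - exact: (nondegenerate_w b0 e0 (th_gt0 _) (th_lt _) k0 w0 erefl a0).
have ord2 (i : 'I_2) : i = ord0 \/ i = ord_max.
  by case: i => [[|[|//]]] lti; [left|right]; exact: val_inj.
move=> i j; case: (ord2 i) (ord2 j) => -> [->|->] // _.
- split=> parity.
    exact: (isosceles_cover_odd b0 e0 (th_gt0 _) (th_lt _) k0 w0 erefl a0 p0 p1 a_coprime erefl).
  exact: (isosceles_cover_even b0 e0 (th_gt0 _) (th_lt _) k0 w0 erefl a0 p0 p1 a_coprime erefl).
- split=> parity.
    exact: (isosceles_cover_odd b1 e1 (th_gt0 _) (th_lt _) k1 w0 erefl a1 p1 p0 coprime1 th1).
  exact: (isosceles_cover_even b1 e1 (th_gt0 _) (th_lt _) k1 w0 erefl a1 p1 p0 coprime1 th1).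
Qed.
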